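(* Let $\gamma\in[-3,-2]$ and let $f$ be a smooth positive probability density on $\mathbb{R}^3$. Then $$\iint_{\mathbb{R}^6}|V_f(v,w)|^2f(v)f(w)\,dv\,dw\le C\Big(1+\int_{\mathbb{R}^3}\big(|\nabla^2\log f|^2+|\nabla\log f|^2+|f|^2\big)f\,dv\Big),$$ where $C=C(\gamma,n,p,\|f\|_{L^\infty},\|f\|_{L^p_n})$ for some $p>3$ and $n>3(p-1)>6$ (i.e. $C$ depends only on the listed quantities and is finite when $\|f\|_{L^\infty}$ and $\|f\|_{L^p_n}$ are finite).
   Context: Notation: $\langle v\rangle=\sqrt{1+|v|^2}$; $\|f\|_{L^p_n}=\big(\int_{\mathbb{R}^3}\langle v\rangle^n|f|^p\,dv\big)^{1/p}$; $A:B=\sum_{\alpha,\beta}A_{\alpha\beta}B_{\alpha\beta}$. Coefficients, for $z\in\mathbb{R}^3$: $a(z)=|z|^\gamma(|z|^2\mathrm{Id}-z\otimes z)$, $b(z)=\nabla\cdot a(z)=-2|z|^\gamma z$ (with $a(0)=0$, $b(0)=0$), and $c(z)=\nabla\cdot b(z)$, i.e. $c(z)=-2(\gamma+3)|z|^\gamma$ if $\gamma>-3$, and $c=-8\pi\delta_0$ if $\gamma=-3$ (so $c*f=-8\pi f$). Test function: $$\begin{aligned}V_f(v,w)=&-a(v-w):\Big(\frac{\nabla^2f}{f}(v)-\nabla\log f(v)\otimes\nabla\log f(w)\Big)-b(v-w)\cdot\big(\nabla\log f(v)-\nabla\log f(w)\big)\\&+(a*f)(v):\frac{\nabla^2f}{f}(v)-(c*f)(v).\end{aligned}$$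 *)

(* Defs.v *)
From HB Require Import structures.
From mathcomp Require Import all_boot all_order all_algebra.
From mathcomp Require Import all_classical all_reals all_analysis.

Set Implicit Arguments.
Unset Strict Implicit.
Unset Printing Implicit Defensive.

Import Order.TTheory GRing.Theory Num.Theory.
Import numFieldNormedType.Exports.

Local Open Scope classical_set_scope.
Local Open Scope ring_scope.

(* Points of R^3 are triples; [measurableTypeR R] is [R] with its Borel
   sigma-algebra. *)
Notation R3 R :=
  (measurableTypeR R * measurableTypeR R * measurableTypeR R)%type.

Lemma sigma_finite_prod d1 d2 (T1 : measurableType d1) (T2 : measurableType d2)
    (R : realType) (m1 : {measure set T1 -> \bar R})
    (m2 : {sigma_finite_measure set T2 -> \bar R}) :
  sigma_finite setT m1 -> sigma_finite setT (m1 \x m2)%E.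
Proof.
move=> /sigma_finiteP[F [TF ndF Foo]].
have /sigma_finiteP[G [TG ndG Goo]] := sigma_finiteT m2.
exists (fun n => F n `*` G n).
  rewrite -setXTT TF TG predeqE => -[x y]; split.
    move=> [/= [n _ Fnx] [k _ Gky]]; exists (maxn n k) => //; split.
    - by move: x Fnx; exact/subsetPset/ndF/leq_maxl.
    - by move: y Gky; exact/subsetPset/ndG/leq_maxr.
  by move=> [n _ []/= ? ?]; split; exists n.
move=> k; have [? ?] := Foo k; have [? ?] := Goo k.
split; first exact: measurableX.
by rewrite product_measure1E// lte_mul_pinfty// ge0_fin_numE.
Qed.

Section Vectors.
Context {R : realType}.

Definition mu3 : set (R3 R) -> \bar R :=
  ((@lebesgue_measure R \x @lebesgue_measure R) \x @lebesgue_measure R)%E.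

HB.instance Definition _ := Measure.on mu3.

Lemma mu3_sigma_finite : sigma_finite setT mu3.
Proof. do 2 apply: sigma_finite_prod; exact: sigma_finiteT. Qed.

HB.instance Definition _ :=
  Measure_isSigmaFinite.Build _ _ _ mu3 mu3_sigma_finite.

Definition coords (v : R * R * R) : 'rV[R]_3 :=
  \row_i [:: v.1.1; v.1.2; v.2]`_i.

Definition unitv (i : 'I_3) : R * R * R :=
  ((i == 0%N :> nat)%:R, (i == 1%N :> nat)%:R, (i == 2%N :> nat)%:R).

Definition dot (x y : 'rV[R]_3) : R := \sum_i x 0 i * y 0 i.

Definition tensor (x y : 'rV[R]_3) : 'M[R]_3 := x^T *m y.

Definition mxdot (A B : 'M[R]_3) : R := \sum_i \sum_j A i j * B i j.

(* The library norm on triples is the sup norm. *)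
Definition enorm (v : R * R * R) : R := Num.sqrt (dot (coords v) (coords v)).

Definition bracket (v : R * R * R) : R := Num.sqrt (1 + enorm v ^+ 2).

End Vectors.

Section Calculus.
Context {R : realType}.
Implicit Types f : R * R * R -> R.

Definition partial (i : 'I_3) f : R * R * R -> R := 'D_(unitv i) f.

Definition partials (s : seq 'I_3) f : R * R * R -> R := foldr partial f s.

(* C^infinity: every iterated partial derivative is (Frechet) differentiable. *)
Definition smooth f : Prop :=
  forall (s : seq 'I_3) (v : R * R * R), differentiable (partials s f) v.

Definition grad f (v : R * R * R) : 'rV[R]_3 := \row_i partial i f v.

Definition hess f (v : R * R * R) : 'M[R]_3 :=
  \matrix_(i, j) partial i (partial j f) v.

Definition log f : R * R * R -> R := fun v => ln (f v).

End Calculus.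

Section Norms.
Context {R : realType}.
Implicit Types f : R * R * R -> R.
Local Open Scope ereal_scope.

Definition normLinf f : \bar R := 'N[mu3]_+oo[EFin \o f].

Definition normLpn (p n : R) f : \bar R :=
  (\int[mu3]_v (bracket v `^ n * `|f v| `^ p)%:E) `^ p^-1.

Definition probability_density f : Prop :=
  [/\ measurable_fun [set: R3 R] f, (forall v, (0 <= f v)%R) &
  \int[mu3]_v (f v)%:E = 1].

End Norms.

Section Coefficients.
Context {R : realType}.
Variable gam : R.
Implicit Types (f : R * R * R -> R) (v w z : R * R * R).

(* At the origin, whatever the value of [0 `^ gam], [coef_a] and [coef_b]
   vanish because [coords 0 = 0]. *)
Definition coef_a z : 'M[R]_3 :=
  enorm z `^ gam *: ((enorm z ^+ 2)%:M - tensor (coords z) (coords z)).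

Definition coef_b z : 'rV[R]_3 := (- 2 * enorm z `^ gam) *: coords z.

Definition conv_a f v : 'M[R]_3 :=
  \matrix_(i, j) \int[mu3]_w (coef_a (v - w) i j * f w).

(* For [gam = -3] the kernel [c] is the measure [- 8 pi delta_0]. *)
Definition conv_c f v : R :=
  if gam == - 3 then - 8 * pi * f v
  else \int[mu3]_w (- 2 * (gam + 3) * enorm (v - w) `^ gam * f w).

Definition V f v w : R :=
  - mxdot (coef_a (v - w))
      ((f v)^-1 *: hess f v - tensor (grad (log f) v) (grad (log f) w))
  - dot (coef_b (v - w)) (grad (log f) v - grad (log f) w)
  + mxdot (conv_a f v) ((f v)^-1 *: hess f v)
  - conv_c f v.

End Coefficients.

(* Main.v *)
(* Write h = log f, z = v - w, and bound |a(z)|^2 by 2 (1 + |z|^-2) and |b(z)|^2 by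
   4 (|z|^-2 + |z|^-4); since z = 0 kills a and b, the convention 0^-1 = 0 is
   harmless.  Convolving f with 1 + |z|^-2, or with |z|^gam if gam > -3, gives a
   bounded function, by a dyadic decomposition of the kernel and f in L^1 and
   L^oo.  So every term of V except the |z|^-4 one is controlled by the integrals
   of |hess h|^2 f, |grad h|^4 f and f^3.
   - The fourth moment of grad h is bounded by the second moment of hess h,
     integrating by parts along coordinate lines.
   - |z|^-4 |grad h(v) - grad h(w)|^2 f(v) f(w) is not absolutely integrable term
     by term; for fixed w, the Hardy inequality
       int |v - w|^-4 psi^2 <= 4 int |v - w|^-2 |grad psi|^2,  psi(w) = 0,
     applied to psi = (d_k h - d_k h(w)) sqrt f brings the exponent back to -2. *)
Require Import Defs.
From HB Require Import structures.
From mathcomp Require Import all_boot all_order all_algebra.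
From mathcomp Require Import all_classical all_reals all_analysis.
From mathcomp Require Import measurable_realfun ess_sup_inf ring lra.

Import Order.TTheory GRing.Theory Num.Theory.
Import numFieldNormedType.Exports.

Local Open Scope classical_set_scope.
Local Open Scope ring_scope.

Set Implicit Arguments.
Unset Strict Implicit.
Unset Printing Implicit Defensive.

(** The power |z|^-4 comes from |b|^2 at gam = -3 and is not locally integrable in R^3, while |z|^-2
    is. The increment of grad h has to compensate for it near v = w, but h is controlled only
    through integrals against f, so no uniform Lipschitz bound on grad h is at hand; the Hardy
    inequality is the integral substitute. The factor sqrt f makes psi^2 carry exactly the weight f.
    Differentiating it costs an increment of grad h times grad h / 2, whose square is quartic in
    grad h: this, besides the tensor products in V, is why a fourth moment is needed. After Hardy
    the integrand is (1 + |v - w|^-2) (E(v) + E(w)) f(v) f(w), where E is [energy]. Each summand is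
    integrated first in the variable that E does not see, which produces a bounded convolution. The
    integrals being compared may be infinite. Hence absorption is done pointwise, before
    integrating, and the integrals over the whole space are only added, scaled and compared. *)

Lemma le_of_eq d (T : porderType d) (x y : T) : x = y -> (x <= y)%O.
Proof. by move=> ->. Qed.

Lemma continuous_exprn_comp (T : topologicalType) (R : realType) (g : T -> R) n :
  continuous g -> continuous (fun x => g x ^+ n).
Proof.
move=> cg x; apply: (@continuous_comp _ _ _ g (fun y => y ^+ n)); first exact: cg.
exact: exprn_continuous.
Qed.

(** * Lebesgue measure on R^3 *)

Section Measurability.
Context {R : realType}.

(** Measurability on triples refers to the product sigma-algebra. Boxes with rational centres and
    radii 1/(k+1) form a countable family of measurable sets, and those contained in U cover it. *)
Lemma open_measurable3 (U : set (R * R * R)) :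
  open U -> measurable (U : set (R3 R)).
Proof.
move=> oU.
pose box (q : rat * rat * rat) (k : nat) : set (R3 R) :=
  (ball (ratr q.1.1 : R) (k.+1%:R^-1) `*` ball (ratr q.1.2 : R) (k.+1%:R^-1)) `*`
   ball (ratr q.2 : R) (k.+1%:R^-1).
have mbox q k : measurable (box q k).
  have mb (y : R) : measurable (ball y k.+1%:R^-1 : set (measurableTypeR R)).
    by apply: open_measurable; apply: ball_open; rewrite invr_gt0 ltr0n.
  exact: (measurableX (measurableX (mb _) (mb _)) (mb _)).
pose good := [set qk : rat * rat * rat * nat | box qk.1 qk.2 `<=` U].
suff -> : (U : set (R3 R)) = \bigcup_(qk in good) box qk.1 qk.2.
  rewrite bigcup_mkcond; apply: countable_bigcupT_measurable => [|qk].
    exact: countableP.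
  by case: ifP.
apply/seteqP; split => [x Ux|x [qk gqk]]; last exact: gqk.
have /nbhs_ballP[e /= e0 xeU] : nbhs x U by exact: open_nbhs_nbhs.
(* A box containing x has all its points within 2/(k+1) of x, hence the bound e / 2. *)
have [k ke] : exists k : nat, k.+1%:R^-1 < e / 2.
  have e20 := divr_gt0 e0 (ltr0n R 2).
  have [k _ /(_ k (leqnn k))] := near_infty_natSinv_lt (PosNum e20).
  by exists k.
have k0 : 0 < k.+1%:R^-1 :> R by rewrite invr_gt0 ltr0n.
have approx (y : R) : exists q : rat, ball (ratr q : R) (k.+1%:R^-1) y.
  move: k.+1%:R^-1 k0 => d d0.
  have [q] := rat_in_itvoo (ltr_pwDr d0 (lexx (y - d))).
  rewrite subrK in_itv/= => /andP[h1 h2]; exists q.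
  by rewrite /ball/= ltr_norml; apply/andP; split; lra.
have [q1 h1] := approx x.1.1; have [q2 h2] := approx x.1.2; have [q3 h3] := approx x.2.
exists (q1, q2, q3, k); last by split; [split|].
move=> y [[y1 y2] y3]; apply: xeU.
have tri (q : rat) (a b : R) : ball (ratr q : R) (k.+1%:R^-1) a ->
    ball (ratr q : R) (k.+1%:R^-1) b -> ball a e b.
  move=> qa qb; apply: (@le_ball _ _ _ (k.+1%:R^-1 + k.+1%:R^-1)).
    by move: k.+1%:R^-1 ke => d de; lra.
  by apply: ball_triangle qb; exact: ball_sym.
by split; [split; [exact: tri h1 y1|exact: tri h2 y2]|exact: tri h3 y3].
Qed.

Lemma continuous_measurable_fun3 (f : R * R * R -> R) :
  continuous f -> measurable_fun [set: R3 R] f.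
Proof.
move=> /continuousP cf; apply: (measurability _ (RGenOpens.measurableE R)).
move=> _ [_ [a [b ->] <-]]; rewrite setTI; apply: open_measurable3.
exact/cf/interval_open.
Qed.

End Measurability.

Section Scaling.
Local Open Scope ereal_scope.

(** The constant is the inverse Jacobian of phi. Phrasing the change of variables through integrals
    of nonnegative functions lets it pass to products by Tonelli. *)
Definition scales d (T : measurableType d) (R : realType)
    (mu : {measure set T -> \bar R}) (phi : T -> T) (c : R) : Prop :=
  measurable_fun [set: T] phi /\
  forall G : T -> \bar R, measurable_fun [set: T] G -> (forall x, 0 <= G x) ->
    \int[mu]_x G (phi x) = c%:E * \int[mu]_x G x.

(** The image of Lebesgue measure under phi, multiplied by c, gives half-open intervals their
    length, so by uniqueness it is Lebesgue measure. *)
Lemma scales_lebesgue (R : realType) (a c : R) : (0 < c)%R ->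
  scales (@lebesgue_measure R)
    ((fun x => a + c * x)%R : measurableTypeR R -> measurableTypeR R) c^-1.
Proof.
move=> c0; set phi : measurableTypeR R -> measurableTypeR R := (fun x => _).
have mphi : measurable_fun [set: measurableTypeR R] phi.
  by apply: measurable_funD => //; exact: measurable_funM.
split => // G mG G0.
have c0' : (0 <= c)%R by exact: ltW.
pose push_phi mp : {measure set (measurableTypeR R) -> \bar R} :=
  @measure_function_pushforward__canonical__measure_function_Measure
    _ _ _ (measurableTypeR R) _ (@lebesgue_measure R) phi mp.
pose nu := mscale (NngNum c0') (push_phi mphi).
have nuE A : measurable A -> lebesgue_measure A = nu A.
  apply: lebesgue_measure_unique => X /ocitvP[->|[[x y]/= xy ->]].
    by rewrite !measure0.
  rewrite /nu /mscale/= /pushforward.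
  have -> : phi @^-1` `]x, y]%classic = `]((x - a) / c)%R, ((y - a) / c)%R]%classic.
    apply/seteqP; split=> t /=; rewrite !in_itv/= /phi ltr_pdivrMr// ler_pdivlMr//.
      by move=> /andP[h1 h2]; apply/andP; split; lra.
    by move=> /andP[h1 h2]; apply/andP; split; lra.
  rewrite !lebesgue_measure_itv/= !lte_fin xy ltr_pM2r ?invr_gt0// ltrD2r xy.
  rewrite -!EFinB -EFinM; congr EFin; field; exact: lt0r_neq0.
rewrite [X in _ = _ * X](eq_measure_integral nu); last by move=> A mA _; exact: nuE.
rewrite ge0_integral_mscale// ge0_integral_pushforward//= preimage_setT.
by rewrite muleA -EFinM mulVf ?mul1e// lt0r_neq0.
Qed.

Lemma scales_prod d1 d2 (T1 : measurableType d1) (T2 : measurableType d2)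
    (R : realType) (m1 : {sigma_finite_measure set T1 -> \bar R})
    (m2 : {sigma_finite_measure set T2 -> \bar R})
    (p1 : T1 -> T1) (p2 : T2 -> T2) (c1 c2 : R) : (0 <= c1)%R -> (0 <= c2)%R ->
  scales m1 p1 c1 -> scales m2 p2 c2 ->
  scales (m1 \x m2) (fun x => (p1 x.1, p2 x.2)) (c1 * c2).
Proof.
move=> c10 c20 [mp1 p1E] [mp2 p2E].
have mp : measurable_fun [set: T1 * T2] (fun x => (p1 x.1, p2 x.2)).
  by apply: measurable_fun_pair; exact: measurableT_comp.
split => // G mG G0.
rewrite fubini_tonelli1//; last exact: (measurableT_comp mG mp).
rewrite [in RHS]fubini_tonelli1//.
transitivity (\int[m1]_x (c2%:E * \int[m2]_y G (p1 x, y))).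
  apply: eq_integral => x _; rewrite /fubini_F/=.
  by rewrite (p2E (fun y => G (p1 x, y)))//; exact: (measurableT_comp mG).
have mF := measurable_fun_fubini_tonelli_F G mG G0 (m2 := m2).
have F0 x : 0 <= \int[m2]_y G (x, y) by exact: integral_ge0.
have mFp : measurable_fun [set: T1] (fun x => \int[m2]_y G (p1 x, y)).
  exact: (measurableT_comp mF mp1).
rewrite (ge0_integralZl m1 measurableT mFp); [|by []|by []].
by rewrite (p1E (fubini_F m2 G))// muleA -EFinM mulrC.
Qed.

Section PlaneMeasure.
Context {R : realType}.

(** The first factor of [mu3], named so that it carries a sigma-finite structure: product lemmas
    then apply to [mu3] as the product of [mu2] and a line. *)
Definition mu2 : set (measurableTypeR R * measurableTypeR R) -> \bar R :=
  @lebesgue_measure R \x @lebesgue_measure R.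

HB.instance Definition _ := Measure.on mu2.

Lemma mu2_sigma_finite : sigma_finite setT mu2.
Proof. apply: sigma_finite_prod; exact: sigma_finiteT. Qed.

HB.instance Definition _ :=
  Measure_isSigmaFinite.Build _ _ _ mu2 mu2_sigma_finite.

End PlaneMeasure.

Lemma integral_mu3_affine (R : realType) (w : R3 R) (c : R) (G : R3 R -> \bar R) :
  (0 < c)%R -> measurable_fun [set: R3 R] G -> (forall x, 0 <= G x) ->
  \int[mu3]_z G (w.1.1 + c * z.1.1, w.1.2 + c * z.1.2, w.2 + c * z.2)%R
    = (c ^- 3)%:E * \int[mu3]_z G z.
Proof.
move=> c0 mG G0.
have ic0 : (0 <= c^-1)%R by rewrite invr_ge0 ltW.
have S a := scales_lebesgue a c0.
have S12 := @scales_prod _ _ _ _ R (@lebesgue_measure R) (@lebesgue_measure R)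
  _ _ _ _ ic0 ic0 (S w.1.1) (S w.1.2).
have [_ H] := @scales_prod _ _ _ _ R
  (@mu2 R) (@lebesgue_measure R)
  _ _ _ _ (mulr_ge0 ic0 ic0) ic0 S12 (S w.2).
by have := H G mG G0; rewrite -!expr2 -exprSr exprVn.
Qed.

End Scaling.

(** * Convolution with a singular kernel *)

(** The integral of a nonnegative function is a supremum over the simple functions below it, so
    monotonicity is free of measurability. This allows bounding the integral of V^2 without studying
    the measurability of V. *)
Lemma ge0_le_integral_nonmeasurable d (T : measurableType d) (R : realType)
    (mu : {measure set T -> \bar R}) (f g : T -> \bar R) :
  (forall x, 0 <= f x)%E -> (forall x, f x <= g x)%E ->
  (\int[mu]_x f x <= \int[mu]_x g x)%E.
Proof.
move=> f0 fg; have g0 x : (0 <= g x)%E := le_trans (f0 x) (fg x).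
rewrite !ge0_integralTE//; apply: le_ereal_sup => _ [h hf <-].
by exists h => // x; exact: le_trans (hf x) (fg x).
Qed.

Section Kernel.
Context {R : realType}.
Implicit Types (v w z : R3 R).

Definition sqn (z : R * R * R) : R := z.1.1 ^+ 2 + z.1.2 ^+ 2 + z.2 ^+ 2.

Lemma sqn_ge0 z : 0 <= sqn z.
Proof. by rewrite !addr_ge0// sqr_ge0. Qed.

Lemma enormE z : enorm z = Num.sqrt (sqn z).
Proof. by rewrite /enorm /dot !big_ord_recl big_ord0 !mxE/= addr0 addrA. Qed.

Lemma enorm_sqr z : enorm z ^+ 2 = sqn z.
Proof. by rewrite enormE sqr_sqrtr// sqn_ge0. Qed.

Lemma enorm_ge0 z : 0 <= enorm z.
Proof. exact: sqrtr_ge0. Qed.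

Lemma ler_enorm (a : R) z :
  [|| a <= `|z.1.1|, a <= `|z.1.2| | a <= `|z.2|] -> a <= enorm z.
Proof.
have h1 := sqr_ge0 z.1.1; have h2 := sqr_ge0 z.1.2; have h3 := sqr_ge0 z.2.
have key x : x ^+ 2 <= sqn z -> a <= `|x| -> a <= enorm z.
  move=> xz ax; apply: le_trans ax _.
  by rewrite enormE -sqrtr_sqr ler_sqrt// sqn_ge0.
by case/or3P; apply: key; rewrite /sqn; lra.
Qed.

(** Balls for the sup norm are cubes of side 2r. *)
Lemma mu3_ball v (r : R) : 0 <= r -> mu3 (ball v r) = ((r *+ 2) ^+ 3)%:E.
Proof.
move=> r0.
have mb (y : R) : measurable (ball y r : set (measurableTypeR R)).
  exact: measurable_ball.
transitivity (mu3 ((ball v.1.1 r `*` ball v.1.2 r) `*` ball v.2 r)).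
  by congr (mu3 _); apply/seteqP; split=> [[[a b] c]|[[a b] c]].
transitivity (mu2 (ball v.1.1 r `*` ball v.1.2 r) * lebesgue_measure (ball v.2 r))%E.
  exact: (product_measure1E (@mu2 R) (@lebesgue_measure R)
    (measurableX (mb _) (mb _)) (mb _)).
transitivity ((lebesgue_measure (ball v.1.1 r) * lebesgue_measure (ball v.1.2 r)) *
    lebesgue_measure (ball v.2 r))%E.
  congr (_ * _)%E.
  exact: (product_measure1E (@lebesgue_measure R) (@lebesgue_measure R) (mb _) (mb _)).
rewrite !lebesgue_measure_ball// -!EFinM.
by congr EFin; rewrite !exprS expr0 mulr1 mulrA.
Qed.

Lemma measurable_ball3 v (r : R) : 0 < r -> measurable (ball v r : set (R3 R)).
Proof. by move=> r0; apply: open_measurable3; exact: ball_open. Qed.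

Local Notation half n := ((2^-1 : R) ^+ n).

Lemma half_gt0 n : 0 < half n. Proof. by rewrite exprn_gt0. Qed.

Lemma dyadic_scale (m : R) : 0 < m < 1 -> exists n, half n.+1 <= m < half n.
Proof.
move=> /andP[m0 m1].
have [k km] : exists k, half k <= m.
  have [k _ /(_ k (leqnn k))/= km] := @near_infty_natSinv_lt R (PosNum m0).
  exists k; apply: le_trans (ltW km).
  by rewrite exprVn lef_pV2 ?posrE ?exprn_gt0// -natrX ler_nat ltn_expl.
case: (ex_minnP (ex_intro (fun k => half k <= m) k km)) => -[|n] nm minn.
  by move: nm; rewrite expr0 leNgt m1.
exists n; rewrite nm ltNge/=; apply/negP => /minn.
by rewrite ltnn.
Qed.

Lemma powR_le0_homo (e a b : R) : e <= 0 -> 0 < a -> a <= b -> b `^ e <= a `^ e.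
Proof.
move=> e0 a0 ab; rewrite -[e]opprK !(powRN _ (- e)).
rewrite lef_pV2 ?posrE ?powR_gt0//; last exact: lt_le_trans ab.
by apply: ge0_ler_powR; rewrite ?oppr_ge0// nnegrE ltW//; exact: lt_le_trans ab.
Qed.

Lemma powR_half (e : R) n : half n `^ e = (2 `^ (- e)) ^+ n.
Proof.
rewrite -powR_mulrn ?invr_ge0// -powR_inv1// -!powRrM -powR_mulrn ?powR_ge0//.
by rewrite -powRrM; congr powR; ring.
Qed.

(** Let m be the sup distance of v and w. If m >= 1 the kernel is at most 1. If 2^-(n+1) <= m <
    2^-n, then w lies in the ball of radius 2^-n, and the summand of index n alone dominates the
    kernel, since the Euclidean distance is at least m. *)
Lemma kernel_le_balls (e : R) v w : e <= 0 ->
  ((enorm (v - w) `^ e)%:E <=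
   1 + \sum_(0 <= n <oo) ((2 `^ (- e)) ^+ n.+1 * \1_(ball v (half n)) w)%:E)%E.
Proof.
move=> e0.
have t0 n : (0 <= ((2 `^ (- e)) ^+ n.+1 * \1_(ball v (half n)) w)%:E)%E.
  by rewrite lee_fin mulr_ge0// exprn_ge0// powR_ge0.
have s0 := nneseries_ge0 (fun n _ _ => t0 n) (N := 0) (P := xpredT).
have le1 : enorm (v - w) `^ e <= 1 -> ((enorm (v - w) `^ e)%:E <=
   1 + \sum_(0 <= n <oo) ((2 `^ (- e)) ^+ n.+1 * \1_(ball v (half n)) w)%:E)%E.
  by move=> h; rewrite (@le_trans _ _ 1%:E) ?lee_fin// leeDl.
pose m := Order.max `|v.1.1 - w.1.1| (Order.max `|v.1.2 - w.1.2| `|v.2 - w.2|).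
have le_m a : a <= m -> a <= enorm (v - w).
  by rewrite /m !le_max => h; apply: ler_enorm.
have m0 : 0 <= m by rewrite /m le_max normr_ge0.
have [m1|m1] := leP 1 m.
  apply: le1; rewrite -(powRr0 (enorm (v - w))); apply: ler_powR => //.
  exact: le_m.
have [m_eq0|/eqP m_neq0] := eqVneq m 0.
  apply: le1; have -> : enorm (v - w) = 0.
    have : `|v.1.1 - w.1.1| <= m by rewrite /m le_max lexx.
    have : `|v.1.2 - w.1.2| <= m by rewrite /m !le_max lexx orbT.
    have : `|v.2 - w.2| <= m by rewrite /m !le_max lexx !orbT.
    rewrite m_eq0 !normr_le0 => /eqP h3 /eqP h2 /eqP h1.
    by rewrite enormE /sqn /= h1 h2 h3 expr0n/= !addr0 sqrtr0.
  have [->|e_neq0] := eqVneq e 0; first by rewrite powRr0.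
  by rewrite powR0.
have [n /andP[nm mn]] : exists n, half n.+1 <= m < half n.
  apply: dyadic_scale; rewrite m1 lt_neqAle m0 andbT eq_sym.
  by apply/andP; split => //; apply/eqP.
have wB : ball v (half n) w.
  move: mn; rewrite /m !gt_max => /and3P[h1 h2 h3].
  by split; [split|].
have := nneseries_lim_ge n.+1 (fun n _ _ => t0 n) (m := 0) (P := xpredT).
move=> h; apply: le_trans (le_trans h _); last by rewrite leeDr.
rewrite big_nat_recr//=; apply: (le_trans _ (leeDr _ _)).
  2: exact: sume_ge0.
rewrite indicE mem_set// mulr1 lee_fin -powR_half.
exact: powR_le0_homo e0 (half_gt0 _) (le_m _ nm).
Qed.

(** The constant 1 of [kernel_le_balls] is charged to the mass of f. The ball of radius 2^-n
    contributes at most c^(n+1) M times its volume 8 * 8^-n, with c = 2^-e; the ratio c / 8 is below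
    1 exactly when e > -3, and K is the sum of the geometric series. *)
Lemma kernel_bound (e : R) : - 3 < e <= 0 ->
  exists2 K : R, 0 <= K & forall (f : R * R * R -> R) (M : R) v,
    measurable_fun [set: R3 R] f -> (forall w, 0 <= f w) ->
    (\int[mu3]_w (f w)%:E = 1)%E ->
    {ae (@mu3 R), forall w, f w <= M} -> 0 <= M ->
    (\int[mu3]_w (enorm (v - w) `^ e * f w)%:E <= (1 + K * M)%:E)%E.
Proof.
move=> /andP[e3 e0]; set c := 2 `^ (- e).
have c0 : 0 < c by rewrite powR_gt0.
have c8 : c < 8.
  have -> : (8 : R) = 2 `^ (- e) * 2 `^ (3 + e).
    rewrite -powRD ?pnatr_eq0 ?implybT//.
    rewrite [X in powR _ X](_ : _ = 3%:R); last by ring.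
    by rewrite powR_mulrn//; ring.
  rewrite ltr_pMr// -[ltLHS]/((fun=> 1) (3 + e)) -powR1.
  by apply: gt0_ltr_powR; rewrite ?nnegrE//; lra.
have c81 : 0 < 1 - c / 8 by lra.
exists (8 * c / (1 - c / 8)); first by rewrite divr_ge0 ?mulr_ge0 ?ltW.
move=> f M v mf f0 f1 fM M0.
have mB n : measurable (ball v (half n) : set (R3 R)).
  by apply: measurable_ball3; exact: half_gt0.
pose t n w := (c ^+ n.+1 * \1_(ball v (half n)) w * f w)%:E.
have mI n : measurable_fun [set: R3 R] (\1_(ball v (half n)) : R3 R -> R).
  exact: measurable_indic.
have mt n : measurable_fun [set: R3 R] (t n).
  by apply/measurable_EFinP; do 2 apply: measurable_funM => //.
have t0 n w : (0 <= t n w)%E.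
  by rewrite lee_fin !mulr_ge0// exprn_ge0// ltW.
have mfE : measurable_fun [set: R3 R] (EFin \o f) by exact/measurable_EFinP.
apply: (@le_trans _ _ (\int[mu3]_w ((f w)%:E + \sum_(0 <= n <oo) t n w))%E).
  apply: ge0_le_integral_nonmeasurable => w.
    by rewrite lee_fin mulr_ge0// powR_ge0.
  have := lee_wpmul2r (f0 w : 0 <= (f w)%:E)%E (kernel_le_balls v w e0).
  rewrite -EFinM => /le_trans; apply.
  rewrite ge0_muleDl ?mul1e; [|by []|].
    2: by apply: nneseries_ge0 => n _ _; rewrite lee_fin mulr_ge0// exprn_ge0// ltW.
  rewrite leeD2l// muleC -nneseriesZl//.
  (* The two series are equal; refuting the strict inequality leaves a comparison term by term. *)
  rewrite leNgt; apply/negP => /lt_eqF /eqP; apply.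
  by apply: eq_eseriesr => n _; rewrite -EFinM; congr EFin; ring.
rewrite ge0_integralD//; last 3 first.
- by move=> w _; rewrite lee_fin.
- by move=> w _; exact: nneseries_ge0.
- by apply: ge0_emeasurable_sum.
rewrite f1 EFinD leeD2l// integral_nneseries//.
apply: (@le_trans _ _ (\sum_(0 <= n <oo) (8 * c * M * (c / 8) ^+ n)%:E)%E).
  apply: lee_nneseries => [n _ _|n _]; first exact: integral_ge0.
  apply: (@le_trans _ _
    (\int[mu3]_w ((c ^+ n.+1 * M)%:E * (\1_(ball v (half n)) w)%:E))%E).
    apply: ae_ge0_le_integral => //.
    - by move=> w _; rewrite lee_fin !mulr_ge0// exprn_ge0// ltW.
    - by apply/measurable_EFinP; exact: measurable_funM.
    apply: filterS fM => w fwM _; rewrite -EFinM lee_fin mulrAC.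
    by rewrite ler_wpM2r// ler_wpM2l// exprn_ge0// ltW.
  rewrite ge0_integralZl//; last 2 first.
  - exact/measurable_EFinP.
  - by rewrite lee_fin mulr_ge0// exprn_ge0// ltW.
  rewrite integral_indic// setIT.
  rewrite [X in (_ * X <= _)%E](_ : _ = ((half n *+ 2) ^+ 3)%:E); last first.
    exact: mu3_ball _ (ltW (half_gt0 n)).
  rewrite -EFinM lee_fin.
  apply: le_of_eq.
  have -> : (half n *+ 2) ^+ 3 = 8 * 8^-1 ^+ n.
    rewrite -mulr_natr exprMn mulrC -exprM mulnC exprM.
    by congr (_ * _ ^+ _); [ring|field].
  by rewrite exprMn exprS; ring.
apply: lime_le; first by apply: is_cvg_nneseries => n _ _;
  rewrite lee_fin !mulr_ge0 ?exprn_ge0 ?divr_ge0// ltW.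
apply: nearW => n; rewrite sumEFin lee_fin.
have := @geometric_le_lim R n (8 * c * M) (c / 8).
rewrite /geometric /series/= => /(_ _ _ _)/le_trans -> //.
- by rewrite !mulr_ge0// ltW.
- by rewrite divr_gt0.
- by rewrite ger0_norm ?divr_ge0 ?ltW//; lra.
- by apply: le_of_eq; ring.
Qed.

End Kernel.

(** * Fourth moment of the logarithmic gradient *)

Section FourthMoment1D.
Context {R : realType}.
Implicit Types f g : R -> R.
Notation mu := (@lebesgue_measure R).

Lemma is_derive_continuous f g :
  (forall x : R, is_derive x (1 : R) f (g x)) -> continuous f.
Proof.
by move=> fg x; apply/differentiable_continuous/derivable1_diffP; case: (fg x).
Qed.

(** If f' were positive beyond a, then f >= f a > 0 on a half-line, against integrability. Such a b
    is a right endpoint where f'^3 / f^2 has the favourable sign. *)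
Lemma ex_derive_le0_right f f1 (a : R) : (forall x, 0 < f x) ->
  (forall x : R, is_derive x (1 : R) f (f1 x)) -> (\int[mu]_x (f x)%:E < +oo)%E ->
  exists2 b, a < b & f1 b <= 0.
Proof.
move=> f0 df ioo; apply: contrapT => nex.
have f1gt x : a < x -> 0 < f1 x.
  by move=> ax; rewrite ltNge; apply/negP => h; apply: nex; exists x.
have cf := is_derive_continuous df.
have fa x : a <= x -> f a <= f x.
  rewrite le_eqVlt => /orP[/eqP->//|ax].
  have [c /[!in_itv]/= /andP[ac _]] := MVT ax (fun y _ => df y)
     (continuous_subspaceT cf).
  by rewrite -subr_ge0 => ->; rewrite mulr_ge0 ?ltW ?subr_gt0 ?f1gt.
suff : (+oo <= \int[mu]_x (f x)%:E)%E by rewrite leNgt ioo.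
apply: (@le_trans _ _ (\int[mu]_(x in `[a, +oo[) (cst (f a)%:E x))%E).
  by rewrite integral_cst//= lebesgue_measure_itv/= ltry gt0_muley ?lte_fin.
rewrite integral_mkcond; apply: ge0_le_integral_nonmeasurable => x.
  by apply: erestrict_ge0 => y _; rewrite lee_fin ltW.
rewrite patchE; case: ifPn; last by rewrite lee_fin ltW.
by rewrite inE/= in_itv/= andbT lee_fin => /fa.
Qed.

Lemma ex_derive_ge0_left f f1 (a : R) : (forall x, 0 < f x) ->
  (forall x : R, is_derive x (1 : R) f (f1 x)) -> (\int[mu]_x (f x)%:E < +oo)%E ->
  exists2 b, b < a & 0 <= f1 b.
Proof.
move=> f0 df ioo; apply: contrapT => nex.
have f1lt x : x < a -> f1 x < 0.
  by move=> ax; rewrite ltNge; apply/negP => h; apply: nex; exists x.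
have cf := is_derive_continuous df.
have fa x : x <= a -> f a <= f x.
  rewrite le_eqVlt => /orP[/eqP->//|ax].
  have [c /[!in_itv]/= /andP[_ ac]] := MVT ax (fun y _ => df y)
     (continuous_subspaceT cf).
  by rewrite -subr_le0 => ->; rewrite mulr_le0_ge0 ?ltW ?subr_gt0 ?f1lt.
suff : (+oo <= \int[mu]_x (f x)%:E)%E by rewrite leNgt ioo.
apply: (@le_trans _ _ (\int[mu]_(x in `]-oo, a]) (cst (f a)%:E x))%E).
  by rewrite integral_cst//= lebesgue_measure_itv/= ltNyr gt0_muley ?lte_fin.
rewrite integral_mkcond; apply: ge0_le_integral_nonmeasurable => x.
  by apply: erestrict_ge0 => y _; rewrite lee_fin ltW.
rewrite patchE; case: ifPn; last by rewrite lee_fin ltW.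
by rewrite inE/= in_itv/= lee_fin => /fa.
Qed.

(* With h = ln f, (f1 ^ 3 / f ^ 2)' = h' ^ 4 f + 3 h' ^ 2 h'' f; integrability of
   f provides arbitrarily large intervals on which the boundary term is
   nonpositive. *)
Lemma log_derive4_le f f1 f2 : (forall x, 0 < f x) ->
  (forall x : R, is_derive x (1 : R) f (f1 x)) ->
  (forall x : R, is_derive x (1 : R) f1 (f2 x)) ->
  continuous f2 -> (\int[mu]_x (f x)%:E < +oo)%E ->
  (\int[mu]_x (f1 x ^+ 4 / f x ^+ 3)%:E <=
   9%:E * \int[mu]_x ((f2 x / f x - (f1 x / f x) ^+ 2) ^+ 2 * f x)%:E)%E.
Proof.
move=> f0 df df1 cf2 ioo.
have fn0 x : f x != 0 by rewrite gt_eqF.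
have cf := is_derive_continuous df; have cf1 := is_derive_continuous df1.
set p := fun x => f1 x ^+ 4 / f x ^+ 3.
set q := fun x => (f2 x / f x - (f1 x / f x) ^+ 2) ^+ 2 * f x.
pose F x := f1 x ^+ 3 / f x ^+ 2.
pose F' x := 3 * f1 x ^+ 2 * f2 x / f x ^+ 2 - 2 * f1 x ^+ 4 / f x ^+ 3.
have dF (x : R) : is_derive x (1 : R) F (F' x).
  have dfx := df x; have df1x := df1 x.
  have -> : F = f1 ^+ 3 * (fun y => (f y)^-1) ^+ 2.
    by apply/funext => y; rewrite /F !fctE exprVn.
  have dV := is_deriveV (fn0 x) dfx.
  apply: is_derive_eq.
  rewrite /F' /GRing.scale/= !fctE/=.
  by field.
have pos n x : 0 <= f x ^+ n by rewrite exprn_ge0// ltW.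
have p0 x : 0 <= p x by rewrite divr_ge0// exprn_even_ge0.
have q0 x : 0 <= q x by rewrite mulr_ge0 ?sqr_ge0// ltW.
(* With h = ln f, p = F' - 3 h'^2 h'' f, and Young's inequality bounds the last term by p / 2 + 9 q
   / 2. Absorbing p / 2 gives the factors 2 and 9; the defect is the square (3 h'' + h'^2)^2 f.
   Being pointwise, the absorption assumes nothing about the integral of p. *)
have pq x : p x <= 9 * q x + 2 * F' x.
  rewrite -subr_ge0.
  have -> : 9 * q x + 2 * F' x - p x =
      (3 * (f2 x / f x) - 2 * (f1 x / f x) ^+ 2) ^+ 2 * f x.
    rewrite /p /q /F'; field.
    exact: fn0.
  by rewrite mulr_ge0 ?sqr_ge0// ltW.
have cV n : continuous (fun x => (f x ^+ n)^-1).
  by move=> x; apply: cvgV; [rewrite expf_neq0|exact: continuous_exprn_comp].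
have cF' : continuous F'.
  move=> x; apply: cvgB; apply: cvgM; try exact: cV.
    apply: cvgM; [|exact: cf2].
    by apply: cvgM; [exact: cvg_cst|exact: continuous_exprn_comp].
  by apply: cvgM; [exact: cvg_cst|exact: continuous_exprn_comp].
have cp : continuous p.
  by move=> x; apply: cvgM; [exact: continuous_exprn_comp|exact: cV].
have cV1 : continuous (fun x => (f x)^-1) by move=> x; apply: cvgV; [|exact: cf].
have cq : continuous q.
  move=> x; apply: cvgM; last exact: cf.
  apply: (@continuous_exprn_comp _ R (fun x => f2 x / f x - (f1 x / f x) ^+ 2)) => y.
  apply: cvgB; first by apply: cvgM; [exact: cf2|exact: cV1].
  apply: (@continuous_exprn_comp _ R (fun x => f1 x / f x)) => z.
  by apply: cvgM; [exact: cf1|exact: cV1].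
have mp : measurable_fun [set: R] (EFin \o p).
  by apply/measurable_EFinP; exact: continuous_measurable_fun.
have mq : measurable_fun [set: R] (EFin \o q).
  by apply/measurable_EFinP; exact: continuous_measurable_fun.
have itv_le a b : a < b -> 0 <= f1 a -> f1 b <= 0 ->
    (\int[mu]_(x in `[a, b]) (p x)%:E <= 9%:E * \int[mu]_x (q x)%:E)%E.
  move=> ab fa fb.
  have int (g : R -> R) : continuous g -> mu.-integrable `[a, b] (EFin \o g).
    move=> cg; apply: continuous_compact_integrable; first exact: segment_compact.
    exact: continuous_subspaceT.
  have FTC : (\int[mu]_(x in `[a, b]) (F' x)%:E = (F b)%:E - (F a)%:E)%E.
    apply: continuous_FTC2 => //; first exact: continuous_subspaceT.
      have cF := is_derive_continuous dF.
      split; first by move=> x _; case: (dF x).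
        exact: cvg_at_right_filter (cF a).
      exact: cvg_at_left_filter (cF b).
    by move=> x _; rewrite derive1E; have [_ ->] := dF x.
  have Fle : F b - F a <= 0.
    rewrite subr_le0 (@le_trans _ _ 0)//.
      by rewrite mulr_le0_ge0 ?invr_ge0 ?pos// exprn_odd_le0.
    by rewrite divr_ge0 ?pos// exprn_ge0.
  apply: (@le_trans _ _ (9%:E * \int[mu]_(x in `[a, b]) (q x)%:E +
      2%:E * \int[mu]_(x in `[a, b]) (F' x)%:E)%E).
    rewrite -!integralZl//; try exact: int.
    rewrite -integralD//; try by apply: integrableZl => //; exact: int.
    apply: le_integral => //; first exact: int.
      by apply: integrableD => //; apply: integrableZl => //; exact: int.
    by move=> x _; rewrite -!EFinM -EFinD lee_fin.
  rewrite FTC -EFinB -EFinM.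
  apply: (@le_trans _ _ (9%:E * \int[mu]_(x in `[a, b]) (q x)%:E)%E).
    by rewrite geeDl// lee_fin pmulr_rle0.
  rewrite lee_wpmul2l ?lee_fin//; apply: ge0_subset_integral => //.
  by move=> x _; rewrite lee_fin.
(* Each [-n, n] is enclosed in an interval with favourable endpoints, and the resulting bound is
   independent of n, as monotone convergence requires. *)
have sym_le n : (\int[mu]_(x in `[(- n%:R)%R, n%:R%R]) (p x)%:E <=
    9%:E * \int[mu]_x (q x)%:E)%E.
  have [b nb fb] := ex_derive_le0_right n%:R f0 df ioo.
  have [a an fa] := ex_derive_ge0_left (- n%:R) f0 df ioo.
  have ab : a < b by have := ler0n R n; move: (n%:R : R) an nb => N; lra.
  apply: le_trans (itv_le a b ab fa fb).
  apply: ge0_subset_integral => //.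
  - exact: measurable_funTS.
  - by move=> x _; rewrite lee_fin.
  - by apply: subset_itvScc; rewrite ltW.
have ndI : nondecreasing_seq (fun n : nat => `[- n%:R, n%:R]%classic : set R).
  move=> n m nm; rewrite subsetEset; apply: subset_itvScc.
    by rewrite bnd_simp lerN2 ler_nat.
  by rewrite bnd_simp ler_nat.
have UI : \bigcup_n (`[- n%:R, n%:R]%classic : set R) = setT.
  apply/seteqP; split => // x _.
  exists (Num.truncn `|x|).+1 => //=; rewrite in_itv/= -ler_norml.
  by rewrite ltW// truncnS_gt.
have := @ge0_nondecreasing_set_cvg_integral _ (measurableTypeR R) R _ (EFin \o p) mu ndI.
rewrite UI => cvgI.
have {}cvgI := cvgI (fun n => measurable_itv _) (fun n => measurable_funTS mp).
rewrite -(cvg_lim _ (cvgI _))//; last by move=> n x _; rewrite lee_fin.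
apply: lime_le; last by apply: nearW => n; exact: sym_le.
by apply/cvg_ex; eexists; apply: cvgI => n x _; rewrite lee_fin.
Qed.

End FourthMoment1D.

Section Slices.
Local Open Scope ereal_scope.
Context d1 d2 (T1 : measurableType d1) (T2 : measurableType d2) (R : realType).
Variables (m1 : {sigma_finite_measure set T1 -> \bar R})
  (m2 : {sigma_finite_measure set T2 -> \bar R}).
Variables (f G H : T1 * T2 -> \bar R) (c : R).
Hypotheses (mf : measurable_fun [set: T1 * T2] f)
  (mG : measurable_fun [set: T1 * T2] G) (mH : measurable_fun [set: T1 * T2] H).
Hypotheses (f0 : forall z, 0 <= f z) (G0 : forall z, 0 <= G z)
  (H0 : forall z, 0 <= H z) (c0 : (0 <= c)%R).
Hypothesis f_fin : \int[m1 \x m2]_z f z < +oo.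

Let ae_fin d (T : measurableType d) (m : {measure set T -> \bar R}) (h : T -> \bar R) :
  measurable_fun [set: T] h -> (forall x, 0 <= h x) -> \int[m]_x h x < +oo ->
  {ae m, forall x, h x < +oo}.
Proof.
move=> mh h0 hoo; have /integrable_ae : m.-integrable [set: T] h.
  apply/integrableP; split => //.
  by under eq_integral do rewrite gee0_abs//.
by move=> /(_ measurableT); apply: filterS => x /(_ I) /fin_numPlt/andP[].
Qed.

(** The inequality is available only on slices where f is integrable. By Tonelli this is almost
    every slice, and the others do not affect the outer integral. *)
Lemma le_integral_slice1 :
  (forall x, \int[m2]_y f (x, y) < +oo ->
    \int[m2]_y G (x, y) <= c%:E * \int[m2]_y H (x, y)) ->
  \int[m1 \x m2]_z G z <= c%:E * \int[m1 \x m2]_z H z.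
Proof.
move=> GH; move: f_fin.
have mF h := @measurable_fun_fubini_tonelli_F _ _ T1 T2 R m2 h.
have F0 (h : T1 * T2 -> \bar R) : (forall z, 0 <= h z) -> forall x, 0 <= fubini_F m2 h x.
  by move=> h0 x; exact: integral_ge0.
rewrite !fubini_tonelli1// => /(ae_fin (mF f mf f0) (F0 f f0)) fin.
rewrite -(ge0_integralZl m1 measurableT (mF H mH H0)); [|by move=> x _; exact: F0|by []].
apply: ae_ge0_le_integral => //.
- by move=> x _; exact: F0.
- exact: mF.
- by move=> x _; apply: mule_ge0 => //; exact: F0.
- by apply: measurable_funeM; exact: mF.
- by apply: filterS fin => x fx _; exact: GH.
Qed.

Lemma le_integral_slice2 :
  (forall y, \int[m1]_x f (x, y) < +oo ->
    \int[m1]_x G (x, y) <= c%:E * \int[m1]_x H (x, y)) ->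
  \int[m1 \x m2]_z G z <= c%:E * \int[m1 \x m2]_z H z.
Proof.
move=> GH; move: f_fin.
have mF h := @measurable_fun_fubini_tonelli_G _ _ T1 T2 R m1 h.
have F0 (h : T1 * T2 -> \bar R) : (forall z, 0 <= h z) -> forall x, 0 <= fubini_G m1 h x.
  by move=> h0 x; exact: integral_ge0.
rewrite !fubini_tonelli2// => /(ae_fin (mF f mf f0) (F0 f f0)) fin.
rewrite -(ge0_integralZl m2 measurableT (mF H mH H0)); [|by move=> x _; exact: F0|by []].
apply: ae_ge0_le_integral => //.
- by move=> x _; exact: F0.
- exact: mF.
- by move=> x _; apply: mule_ge0 => //; exact: F0.
- by apply: measurable_funeM; exact: mF.
- by apply: filterS fin => x fx _; exact: GH.
Qed.

End Slices.

Section ChainRule.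
Context {R : realType}.
Implicit Types phi : R * R * R -> R.

Lemma diff_partial phi v (u : R * R * R) : differentiable phi v ->
  'd phi v u = u.1.1 * partial ord0 phi v + u.1.2 * partial (inord 1) phi v
    + u.2 * partial ord_max phi v.
Proof.
move=> dphi.
have uE : u = u.1.1 *: unitv ord0 + u.1.2 *: unitv (inord 1) + u.2 *: unitv ord_max.
  case: u => [[a b] c]; rewrite /unitv inordK//=.
  by congr (_, _, _); rewrite /= /GRing.scale/= ?mulr1 ?mulr0 ?addr0 ?add0r.
by rewrite [in LHS]uE !linearD !linearZ /= /partial !deriveE.
Qed.

(** Serves both the coordinate lines of the fourth moment and the curves w + s^2 z of the Hardy
    inequality. *)
Lemma is_derive_curve phi (a b c : R -> R) (a' b' c' t : R) :
  is_derive t (1 : R) a a' -> is_derive t (1 : R) b b' -> is_derive t (1 : R) c c' ->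
  differentiable phi (a t, b t, c t) ->
  is_derive t (1 : R) (fun s => phi (a s, b s, c s))
    (a' * partial ord0 phi (a t, b t, c t) + b' * partial (inord 1) phi (a t, b t, c t)
    + c' * partial ord_max phi (a t, b t, c t)).
Proof.
move=> da db dc dphi.
have ha : differentiable a t by apply/derivable1_diffP; case: da.
have hb : differentiable b t by apply/derivable1_diffP; case: db.
have hc : differentiable c t by apply/derivable1_diffP; case: dc.
pose g s := (a s, b s, c s).
have hab : differentiable (fun s => (a s, b s)) t by exact: differentiable_pair.
have hg : differentiable g t by exact: differentiable_pair.
have hcomp : differentiable (phi \o g) t by exact: differentiable_comp.
apply: DeriveDef; first exact/derivable1_diffP.
rewrite -[fun s => _]/(phi \o g) deriveE// diff_comp//=.
rewrite diff_partial//.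
have -> : 'd g t 1 = (a', b', c').
  rewrite /g diff_pair//= diff_pair//= -!deriveE//.
  by have [_ ->] := da; have [_ ->] := db; have [_ ->] := dc.
by [].
Qed.

End ChainRule.

Section FourthMoment.
Context {R : realType}.
Implicit Types f : R * R * R -> R.

Lemma ord3P (P : 'I_3 -> Prop) :
  P ord0 -> P (inord 1) -> P ord_max -> forall i, P i.
Proof.
move=> P0 P1 P2 [[|[|[|//]]] lti].
- by rewrite (_ : Ordinal _ = ord0)//; exact: val_inj.
- by rewrite (_ : Ordinal _ = inord 1)//; apply: val_inj; rewrite /= inordK.
- by rewrite (_ : Ordinal _ = ord_max)//; exact: val_inj.
Qed.

Lemma smooth_partial f i : smooth f -> smooth (partial i f).
Proof. by move=> sf s v; have := sf (rcons s i) v; rewrite /partials foldr_rcons. Qed.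

Lemma smooth_differentiable f v : smooth f -> differentiable f v.
Proof. by move=> sf; exact: (sf [::]). Qed.

Lemma smooth_continuous f : smooth f -> continuous f.
Proof. by move=> sf v; apply/differentiable_continuous/smooth_differentiable. Qed.

(** For h = log f, this is (d_i h)^4 f, and [log_hess_sqr] is (d_i d_i h)^2 f; both are written
    through f as in [log_derive4_le], to which their restrictions to lines are submitted. *)
Definition log_quartic i f v := partial i f v ^+ 4 / f v ^+ 3.
Definition log_hess_sqr i f v :=
  (partial i (partial i f) v / f v - (partial i f v / f v) ^+ 2) ^+ 2 * f v.

Lemma integral_log_quartic_le f i : smooth f -> (forall v, 0 < f v) ->
  (\int[mu3]_v (f v)%:E < +oo)%E ->
  (\int[mu3]_v (log_quartic i f v)%:E <=
   9%:E * \int[mu3]_v (log_hess_sqr i f v)%:E)%E.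
Proof.
move=> sf f0 ioo.
have sg := smooth_partial i sf; have sh := smooth_partial i sg.
have cf := smooth_continuous sf; have cg := smooth_continuous sg.
have ch := smooth_continuous sh.
have cV n : continuous (fun x => (f x ^+ n)^-1).
  by move=> x; apply: cvgV; [rewrite expf_neq0// gt_eqF|exact: continuous_exprn_comp].
have cV1 : continuous (fun x => (f x)^-1).
  by move=> x; apply: cvgV; [rewrite gt_eqF|exact: cf].
have mf : measurable_fun [set: R3 R] (EFin \o f).
  by apply/measurable_EFinP; exact: continuous_measurable_fun3.
have mp : measurable_fun [set: R3 R] (EFin \o log_quartic i f).
  apply/measurable_EFinP; apply: continuous_measurable_fun3 => x.
  by apply: cvgM; [exact: continuous_exprn_comp|exact: cV].
have mq : measurable_fun [set: R3 R] (EFin \o log_hess_sqr i f).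
  apply/measurable_EFinP; apply: continuous_measurable_fun3 => x.
  apply: cvgM; last exact: cf.
  apply: (@continuous_exprn_comp _ R (fun x => _ - _)) => y.
  apply: cvgB; first by apply: cvgM; [exact: ch|exact: cV1].
  apply: (@continuous_exprn_comp _ R (fun x => _ / _)) => z.
  by apply: cvgM; [exact: cg|exact: cV1].
have fE0 v : (0 <= (EFin \o f) v)%E by rewrite lee_fin ltW.
have p0 v : (0 <= (EFin \o log_quartic i f) v)%E.
  by rewrite lee_fin; apply: divr_ge0; [exact: exprn_even_ge0|rewrite exprn_ge0// ltW].
have q0 v : (0 <= (EFin \o log_hess_sqr i f) v)%E.
  by rewrite lee_fin mulr_ge0 ?sqr_ge0// ltW.
have c9 : 0 <= (9 : R) by [].
have slice1 := @le_integral_slice1 _ _ _ _ R (@mu2 R) (@lebesgue_measure R)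
  _ _ _ 9 mf mp mq fE0 p0 q0 c9 ioo.
have slice2 := @le_integral_slice2 _ _ _ _ R (@mu2 R) (@lebesgue_measure R)
  _ _ _ 9 mf mp mq fE0 p0 q0 c9 ioo.
have line (a b c : R -> R) : (forall t : R, is_derive t (1 : R) a (unitv i).1.1) ->
    (forall t : R, is_derive t (1 : R) b (unitv i).1.2) ->
    (forall t : R, is_derive t (1 : R) c (unitv i).2) ->
    let l (t : measurableTypeR R) : R3 R := (a t, b t, c t) in
    (\int[lebesgue_measure]_t (f (l t))%:E < +oo)%E ->
    (\int[lebesgue_measure]_t (log_quartic i f (l t))%:E <=
     9%:E * \int[lebesgue_measure]_t (log_hess_sqr i f (l t))%:E)%E.
  move=> da db dc l lfin.
  have dl g : smooth g -> forall t : R, is_derive t (1 : R) (g \o l) (partial i g (l t)).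
    move=> sg' t; have dg := smooth_differentiable (l t) sg'.
    have := is_derive_curve (da t) (db t) (dc t) dg.
    by rewrite -(diff_partial (unitv i) dg) /partial deriveE.
  exact: (@log_derive4_le R (f \o l) (partial i f \o l) (partial i (partial i f) \o l)
    (fun t => f0 (l t)) (dl _ sf) (dl _ sg) (is_derive_continuous (dl _ sh)) lfin).
have cst0 (a t : R) : is_derive t (1 : R) (fun=> a) 0 by exact: is_derive_cst.
have id1 (t : R) : is_derive t (1 : R) (fun s => s) 1 by exact: is_derive_id.
move: i line slice1 slice2 {sg sh cg ch} mp mq p0 q0.
(* In (R x R) x R, lines along the last axis are reached by one slicing; the other two axes need a
   second slicing, of the plane. *)
apply: ord3P => line slice1 slice2 mp mq p0 q0.
- apply: slice2 => z zfin.
  have mz (h : R3 R -> \bar R) : measurable_fun [set: R3 R] h ->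
    measurable_fun setT (fun x => h (x, z)) by move=> mh; exact: measurableT_comp.
  apply: (@le_integral_slice2 _ _ _ _ R (@lebesgue_measure R) (@lebesgue_measure R)
     _ _ _ 9 (mz _ mf) (mz _ mp) (mz _ mq)) => // y yfin.
  exact: (line (fun t => t) (fun=> y) (fun=> z)).
- apply: slice2 => z zfin.
  have mz (h : R3 R -> \bar R) : measurable_fun [set: R3 R] h ->
    measurable_fun setT (fun x => h (x, z)) by move=> mh; exact: measurableT_comp.
  apply: (@le_integral_slice1 _ _ _ _ R (@lebesgue_measure R) (@lebesgue_measure R)
     _ _ _ 9 (mz _ mf) (mz _ mp) (mz _ mq)) => // x xfin.
  by apply: (line (fun=> x) (fun t => t) (fun=> z)) => // t; rewrite /unitv inordK.
- apply: slice1 => -[x y] xyfin.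
  exact: (line (fun=> x) (fun=> y) (fun t => t)).
Qed.

End FourthMoment.

(** * Hardy inequality *)

(** On nonnegative reals the inverse is the real power of exponent -1, also at 0, where both are
    0. *)
Lemma measurable_funV_ge0 d (T : measurableType d) (R : realType) (g : T -> R) :
  (forall x, 0 <= g x) -> measurable_fun [set: T] g ->
  measurable_fun [set: T] (fun x => (g x)^-1).
Proof.
move=> g0 mg; rewrite (_ : (fun x => _) = (fun x => g x `^ (-1))).
  exact: (measurableT_comp (measurable_powR _)).
by apply/funext => x; rewrite powR_inv1.
Qed.

Section Hardy.
Context {R : realType}.
Implicit Types psi : R * R * R -> R.

(** Cauchy-Schwarz on [0, 1] in tangent form: k'^2 >= 2 k(1) k' - k(1)^2 pointwise, and the right
    side integrates to 2 k(1)^2 - k(1)^2 because k(0) = 0. *)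
Lemma sqr_le_integral_derive_sqr (k k' : R -> R) :
  (forall t : R, is_derive t (1 : R) k (k' t)) -> continuous k' -> k 0 = 0 ->
  ((k 1 ^+ 2)%:E <= \int[@lebesgue_measure R]_(t in `[0%R, 1%R]) (k' t ^+ 2)%:E)%E.
Proof.
move=> dk ck' k0.
have ck := is_derive_continuous dk.
have ck2 : continuous (fun t => k' t ^+ 2) by exact: continuous_exprn_comp.
have int (g : R -> R) : continuous g ->
    lebesgue_measure.-integrable `[(0:R), 1] (EFin \o g).
  move=> cg; apply: continuous_compact_integrable; first exact: segment_compact.
  exact: continuous_subspaceT.
have FTC : (\int[@lebesgue_measure R]_(x in `[0%R, 1%R]) (k' x)%:E =
    (k 1)%:E - (k 0)%:E)%E.
  apply: continuous_FTC2 => //; first exact: continuous_subspaceT.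
    split; first by move=> x _; case: (dk x).
      exact: cvg_at_right_filter (ck 0).
    exact: cvg_at_left_filter (ck 1).
  by move=> x _; rewrite derive1E; have [_ ->] := dk x.
have c1 : continuous (fun _ : R => 1 : R) by move=> x; exact: cvg_cst.
pose h (x : R) := 2 * k 1 * k' x + - (k 1 ^+ 2) * 1.
have ch : continuous h.
  move=> x; apply: cvgD; last exact: cvg_cst.
  by apply: cvgM; [exact: cvg_cst|exact: ck'].
have -> : ((k 1 ^+ 2)%:E = \int[@lebesgue_measure R]_(t in `[0%R, 1%R]) (h t)%:E)%E.
  rewrite /h; under eq_integral do rewrite EFinD !EFinM.
  rewrite integralD//; try by apply: integrableZl => //; exact: int.
  rewrite !integralZl//; try exact: int.
  rewrite FTC k0 sube0 -EFinM (_ : (fun=> 1%:E) = cst 1%:E)// integral_cst//=.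
  rewrite mul1e lebesgue_measure_itv/= lte_fin ltr01 oppr0 adde0 -EFinM -EFinD.
  by congr EFin; ring.
apply: le_integral => //; try exact: int.
move=> t _; rewrite lee_fin -subr_ge0 /h.
by rewrite (_ : _ - _ = (k' t - k 1) ^+ 2) ?sqr_ge0//; ring.
Qed.

Definition gradsq psi v := partial ord0 psi v ^+ 2 + partial (inord 1) psi v ^+ 2
  + partial ord_max psi v ^+ 2.

Lemma gradsq_ge0 psi v : 0 <= gradsq psi v.
Proof. by rewrite !addr_ge0// sqr_ge0. Qed.

Lemma measurable_coords d (T : measurableType d) (g : T -> R3 R) :
  measurable_fun [set: T] g ->
  [/\ measurable_fun [set: T] (fun x => (g x).1.1),
      measurable_fun [set: T] (fun x => (g x).1.2) &
      measurable_fun [set: T] (fun x => (g x).2)].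
Proof.
move=> mg; have mg1 := measurableT_comp measurable_fst mg.
split; [exact: (measurableT_comp measurable_fst mg1)|
        exact: (measurableT_comp measurable_snd mg1)|
        exact: (measurableT_comp measurable_snd mg)].
Qed.

Lemma measurable_affine d (T : measurableType d) w (g : T -> R) (h : T -> R3 R) :
  measurable_fun [set: T] g -> measurable_fun [set: T] h ->
  measurable_fun [set: T] (fun x => (w.1.1 + g x * (h x).1.1,
    w.1.2 + g x * (h x).1.2, w.2 + g x * (h x).2) : R3 R).
Proof.
move=> mg /measurable_coords[m1 m2 m3].
have mc (k : T -> R) (a : R) : measurable_fun [set: T] k ->
    measurable_fun [set: T] (fun x => a + g x * k x).
  move=> mk; have mgk := measurable_funM mg mk.
  exact: (measurable_funD (measurable_cst a) mgk).
exact: (measurable_fun_pair (measurable_fun_pair (mc _ _ m1) (mc _ _ m2)) (mc _ _ m3)).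
Qed.

Lemma measurable_subR3 d (T : measurableType d) (g h : T -> R3 R) :
  measurable_fun [set: T] g -> measurable_fun [set: T] h ->
  measurable_fun [set: T] (fun x => g x - h x : R3 R).
Proof.
move=> /measurable_coords[g1 g2 g3] /measurable_coords[h1 h2 h3].
exact: (measurable_fun_pair (measurable_fun_pair (measurable_funB g1 h1)
  (measurable_funB g2 h2)) (measurable_funB g3 h3)).
Qed.

Lemma measurable_sqn d (T : measurableType d) (g : T -> R3 R) :
  measurable_fun [set: T] g -> measurable_fun [set: T] (fun x => sqn (g x)).
Proof.
move=> /measurable_coords[m1 m2 m3].
exact: (measurable_funD (measurable_funD (measurable_funX _ m1) (measurable_funX _ m2))
  (measurable_funX _ m3)).
Qed.

Lemma cauchy_schwarz3 (a b c x y z : R) :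
  (a * x + b * y + c * z) ^+ 2 <= (a ^+ 2 + b ^+ 2 + c ^+ 2) * (x ^+ 2 + y ^+ 2 + z ^+ 2).
Proof.
rewrite -subr_ge0.
rewrite (_ : _ - _ = (a * y - b * x) ^+ 2 + (a * z - c * x) ^+ 2 + (b * z - c * y) ^+ 2).
  by rewrite !addr_ge0// sqr_ge0.
by ring.
Qed.

(* Write psi (w + z) as the integral over s in [0, 1] of the derivative of
   s |-> psi (w + s ^ 2 z): the substitution z |-> s ^ 2 z then has a Jacobian
   cancelling every power of s. *)
Lemma hardy psi w : (forall v, differentiable psi v) ->
  (forall i, continuous (partial i psi)) -> psi w = 0 ->
  (\int[mu3]_v (sqn (v - w) ^- 2 * psi v ^+ 2)%:E <=
   4%:E * \int[mu3]_v ((sqn (v - w))^-1 * gradsq psi v)%:E)%E.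
Proof.
move=> dpsi cpsi psiw.
have cpsi0 : continuous psi by move=> v; exact: differentiable_continuous.
have mpsi : measurable_fun [set: R3 R] psi by exact: continuous_measurable_fun3.
have mw : measurable_fun [set: R3 R] (fun v : R3 R => v - w : R3 R).
  exact: (measurable_subR3 (@measurable_id _ (R3 R) setT) (measurable_cst w)).
have mgrad : measurable_fun [set: R3 R] (gradsq psi).
  by apply: measurable_funD; [apply: measurable_funD|]; apply: measurable_funX;
    exact: continuous_measurable_fun3.
have msq : measurable_fun [set: R3 R] (fun v : R3 R => (sqn (v - w))^-1).
  apply: measurable_funV_ge0; first by move=> v; exact: sqn_ge0.
  exact: measurable_sqn mw.
pose G (v : R3 R) := (sqn (v - w))^-1 * gradsq psi v.
have mG : measurable_fun [set: R3 R] G by exact: measurable_funM.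
have G0 v : 0 <= G v by rewrite mulr_ge0 ?invr_ge0 ?sqn_ge0 ?gradsq_ge0.
pose L (v : R3 R) := (sqn (v - w)) ^- 2 * psi v ^+ 2.
have mL : measurable_fun [set: R3 R] L.
  apply: measurable_funM; last exact: measurable_funX.
  by under eq_fun do rewrite -exprVn; exact: measurable_funX.
have L0 v : 0 <= L v by rewrite mulr_ge0 ?invr_ge0 ?sqr_ge0.
pose l (s : R) (z : R3 R) : R3 R := (w.1.1 + s * z.1.1, w.1.2 + s * z.1.2, w.2 + s * z.2).
have sqn_l s z : sqn (l s z - w) = s ^+ 2 * sqn z by rewrite /sqn/=; ring.
(* The factor 4 s^6 is 4 s^2, from the squared speed of s |-> w + s^2 z, times s^4, from |z|^-2 =
   s^4 |s^2 z|^-2. With s^p in place of s^2 the final constant would be p^2 / (p - 1), which is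
   least at p = 2. *)
pose HH (sz : measurableTypeR R * R3 R) :=
  ((\1_(`[0%R, 1%R]%classic : set R) sz.1 * (4 * sz.1 ^+ 6)) * G (l (sz.1 ^+ 2) sz.2))%:E.
have ml d (T : measurableType d) (g : T -> R) (h : T -> R3 R) :
    measurable_fun setT g -> measurable_fun setT h ->
    measurable_fun setT (fun x => l (g x) (h x)).
  exact: measurable_affine.
have mfst : measurable_fun [set: measurableTypeR R * R3 R] (fun sz => sz.1 : R).
  exact: measurable_fst.
have mHH : measurable_fun setT HH.
  apply/measurable_EFinP; apply: measurable_funM; [apply: measurable_funM|].
  - by apply: (measurableT_comp _ mfst); exact: measurable_indic.
  - by apply: measurable_funM => //; exact: measurable_funX.
  - apply: (measurableT_comp mG).
    by apply: ml; [exact: measurable_funX|exact: measurable_snd].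
have HH0 sz : (0 <= HH sz)%E.
  by rewrite lee_fin mulr_ge0// mulr_ge0// mulr_ge0// exprn_even_ge0.
have := @integral_mu3_affine R w 1 (EFin \o L) ltr01 _ _.
rewrite expr1n invr1 mul1e => <-; [|exact/measurable_EFinP|by move=> v; rewrite lee_fin].
apply: (@le_trans _ _ (\int[mu3]_z \int[lebesgue_measure]_s HH (s, z))%E).
  apply: ge0_le_integral => //.
  - by move=> z _; rewrite lee_fin.
  - have ml1 : measurable_fun [set: R3 R] (l 1).
      exact: (ml _ _ _ _ (measurable_cst (1 : R)) (@measurable_id _ (R3 R) setT)).
    by apply: (measurableT_comp _ ml1); exact/measurable_EFinP.
  - exact: (measurable_fun_fubini_tonelli_G HH).
  - move=> z _.
    pose a (s : R) := w.1.1 + s ^+ 2 * z.1.1; pose b (s : R) := w.1.2 + s ^+ 2 * z.1.2.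
    pose c (s : R) := w.2 + s ^+ 2 * z.2.
    have dlin (x y t : R) : is_derive t (1 : R) (fun s => x + s ^+ 2 * y) (2 * t * y).
      have dx : is_derive t (1 : R) (fun=> x) 0 by exact: is_derive_cst.
      have dy : is_derive t (1 : R) (fun=> y) 0 by exact: is_derive_cst.
      have did : is_derive t (1 : R) (fun s => s) 1 by exact: is_derive_id.
      have := is_deriveD dx (is_deriveM (is_deriveX 2 did) dy).
      move=> /is_derive_eq; apply; rewrite /GRing.scale/= !fctE/=; ring.
    have da t := dlin w.1.1 z.1.1 t; have db t := dlin w.1.2 z.1.2 t.
    have dc t := dlin w.2 z.2 t.
    pose k (s : R) := psi (a s, b s, c s).
    pose k' (s : R) := 2 * s * z.1.1 * partial ord0 psi (l (s ^+ 2) z) +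
      2 * s * z.1.2 * partial (inord 1) psi (l (s ^+ 2) z) +
      2 * s * z.2 * partial ord_max psi (l (s ^+ 2) z).
    have dk (t : R) : is_derive t (1 : R) k (k' t).
      exact: (is_derive_curve (da t) (db t) (dc t) (dpsi _)).
    have ck' : continuous k'.
      have cl : continuous (fun s => (a s, b s, c s)).
        have df g g' : (forall t : R, is_derive t (1 : R) g (g' t)) ->
            forall t, differentiable g t.
          by move=> dg t; apply/derivable1_diffP; case: (dg t).
        move=> s; apply: differentiable_continuous; apply: differentiable_pair.
          by apply: differentiable_pair; [exact: df da _|exact: df db _].
        exact: df dc _.
      have cterm (y : R) i :
          continuous (fun s : R => 2 * s * y * partial i psi (a s, b s, c s)).
        move=> s; apply: cvgM; last first.
          by apply: (@continuous_comp _ _ _ (fun s => (a s, b s, c s)) (partial i psi));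
            [exact: cl|exact: cpsi].
        by apply: cvgM; [apply: cvgM; [exact: cvg_cst|exact: cvg_id]|exact: cvg_cst].
      by move=> s; apply: cvgD; [apply: cvgD|]; exact: cterm.
    have k0 : k 0 = 0.
      rewrite /k /a /b /c expr0n/= !mul0r !addr0 -[RHS]psiw.
      by congr psi; case: (w) => [[]].
    have k1 : L (l 1 z) = sqn z ^- 2 * k 1 ^+ 2.
      by rewrite /L sqn_l expr1n mul1r /k /a /b /c expr1n.
    have mk' : measurable_fun `[(0:R), 1] (fun s => (k' s ^+ 2)%:E).
      apply/measurable_EFinP; apply: measurable_funTS; apply: measurable_funX.
      exact: continuous_measurable_fun.
    rewrite [leLHS](_ : _ = (L (l 1 z))%:E)// k1 EFinM.
    apply: (@le_trans _ _ ((sqn z ^- 2)%:E *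
        \int[lebesgue_measure]_(t in `[0%R, 1%R]) (k' t ^+ 2)%:E)%E).
      rewrite lee_wpmul2l ?lee_fin ?invr_ge0 ?sqr_ge0//.
      exact: sqr_le_integral_derive_sqr dk ck' k0.
    rewrite -ge0_integralZl//; last 2 first.
    - by move=> t _; rewrite lee_fin sqr_ge0.
    - by rewrite lee_fin invr_ge0 sqr_ge0.
    rewrite integral_mkcond; apply: ge0_le_integral_nonmeasurable => s.
      apply: erestrict_ge0 => t _.
      by rewrite -EFinM lee_fin mulr_ge0 ?invr_ge0 ?sqr_ge0.
    rewrite patchE /HH indicE; case: ifPn => [s01|_]; last by rewrite lee_fin !mul0r.
    rewrite mul1r -EFinM lee_fin /G/= sqn_l.
    (* The cancellation of powers divides by s and z. If either vanishes both sides are 0, for z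
       thanks to the convention 0^-1 = 0. *)
    have [->|s_neq0] := eqVneq s 0.
      by rewrite /k' !(mulr0, mul0r, addr0) !expr0n/= !(mulr0, mul0r).
    have [->|z_neq0] := eqVneq (sqn z) 0.
      by rewrite expr2 !(mulr0, invr0, mul0r).
    apply: (@le_trans _ _ (sqn z ^- 2 *
        (4 * s ^+ 2 * (sqn z * gradsq psi (l (s ^+ 2) z))))).
      rewrite ler_wpM2l ?invr_ge0 ?sqr_ge0//.
      have -> : k' s = 2 * s * (z.1.1 * partial ord0 psi (l (s ^+ 2) z) +
        z.1.2 * partial (inord 1) psi (l (s ^+ 2) z) +
        z.2 * partial ord_max psi (l (s ^+ 2) z)).
        rewrite /k'; move: (partial ord0 psi _) (partial (inord 1) psi _)
          (partial ord_max psi _) => p0 p1 p2; ring.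
      rewrite exprMn (_ : (2 * s) ^+ 2 = 4 * s ^+ 2); last by ring.
      by rewrite ler_wpM2l ?cauchy_schwarz3// mulr_ge0 ?sqr_ge0.
    move: (gradsq _ _) => g.
    by apply: le_of_eq; field; rewrite z_neq0 s_neq0.
rewrite -(@fubini_tonelli _ _ _ _ R (@lebesgue_measure R) (@mu3 R) HH)//.
pose I := (\int[mu3]_v (G v)%:E)%E.
(* For s in ]0, 1] the substitution of ratio s^2 has inverse Jacobian s^-6, so the integral in z is
   4 I whatever s is. *)
apply: (@le_trans _ _ (\int[lebesgue_measure]_s
    ((4%:E * I) * (\1_(`[0%R, 1%R]%classic : set R) s)%:E))%E).
  apply: ge0_le_integral_nonmeasurable => s; first by apply: integral_ge0 => z _.
  rewrite indicE /HH; under eq_integral do rewrite /= indicE.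
  have [s01|s01] := boolP (s \in `[0%R, 1%R]%classic); last first.
    rewrite mule0; under eq_integral do rewrite !mul0r.
    by rewrite integral0.
  rewrite mule1 mul1r.
  have [->|s_neq0] := eqVneq s 0.
    under eq_integral do rewrite expr0n mulr0 mul0r.
    by rewrite integral0 mule_ge0// integral_ge0// => v _; rewrite lee_fin.
  have s20 : 0 < s ^+ 2 by rewrite exprn_even_gt0.
  have := @integral_mu3_affine R w (s ^+ 2) (EFin \o G) s20.
  move=> /(_ _ _)/= intE.
  under eq_integral do rewrite EFinM.
  rewrite ge0_integralZl; last 4 first.
  - exact: measurableT.
  - apply/measurable_EFinP; apply: (measurableT_comp mG).
    exact: (ml _ _ _ _ (measurable_cst (s ^+ 2)) (@measurable_id _ (R3 R) setT)).
  - by move=> z _; rewrite lee_fin.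
  - by rewrite lee_fin mulr_ge0// exprn_even_ge0.
  rewrite intE; [|exact/measurable_EFinP|by move=> v; rewrite lee_fin].
  rewrite muleA -EFinM.
  by rewrite (_ : 4 * s ^+ 6 * (s ^+ 2) ^- 3 = 4)//; field.
rewrite ge0_integralZl//; last 2 first.
- by apply/measurable_EFinP; exact: measurable_indic.
- by rewrite mule_ge0// integral_ge0// => v _; rewrite lee_fin.
rewrite integral_indic// setIT/= lebesgue_measure_itv/= lte_fin ltr01 oppr0 adde0.
by rewrite mule1.
Qed.

End Hardy.

(** * Weighted estimates *)

Section LogCalculus.
Context {R : realType}.
Implicit Types f : R * R * R -> R.

Lemma is_derive_partial f i v : differentiable f v ->
  is_derive v (unitv i) f (partial i f v).
Proof. by move=> df; apply/derivableP/diff_derivable. Qed.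

Lemma differentiable_comp1 (u : R -> R) u' f v : differentiable f v ->
  is_derive (f v) (1 : R) u u' -> differentiable (u \o f) v.
Proof.
move=> df du; apply: differentiable_comp => //.
by apply/derivable1_diffP; case: du.
Qed.

Lemma partial_comp (u : R -> R) u' f i v : differentiable f v ->
  is_derive (f v) (1 : R) u u' -> partial i (u \o f) v = u' * partial i f v.
Proof.
move=> df du.
have dfu : differentiable u (f v) by apply/derivable1_diffP; case: du.
have dc : differentiable (u \o f) v by exact: differentiable_comp.
rewrite /partial !deriveE// diff_comp//=.
have duE : 'd u (f v) 1 = u' by rewrite -deriveE//; case: du.
transitivity ('d u (f v) ('d f v (unitv i) *: (1 : R))).
  by congr ('d u _ _); rewrite [RHS]mulr1.
by rewrite linearZ/= duE [LHS]mulrC.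
Qed.

Lemma is_derive_partial_comp (u : R -> R) u' f i v : differentiable f v ->
  is_derive (f v) (1 : R) u u' ->
  is_derive v (unitv i) (u \o f) (u' * partial i f v).
Proof.
move=> df du; rewrite -(partial_comp i df du).
exact/is_derive_partial/(differentiable_comp1 df du).
Qed.

Lemma is_derive1_inv (x : R) : x != 0 ->
  is_derive x (1 : R) (fun y => y^-1) (- x ^- 2).
Proof.
move=> x0; have did : is_derive x (1 : R) (fun y => y) 1 by exact: is_derive_id.
have := is_deriveV x0 did.
by rewrite [X in is_derive _ _ _ X](_ : _ = - x ^- 2)//; exact: mulr1.
Qed.

(** With h = log f these are d_i h and d_i d_j h, by [partial_log] and [partial_lgrad]. The quotient
    form exposes the ratio of the Hessian of f to f that occurs in V. *)
Definition lgrad f (i : 'I_3) v := partial i f v / f v.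
Definition lhess f (i j : 'I_3) v :=
  partial i (partial j f) v / f v - lgrad f i v * lgrad f j v.

Variable f : R * R * R -> R.
Hypotheses (sf : smooth f) (f0 : forall v, 0 < f v).

Let fn0 v : f v != 0. Proof. by rewrite gt_eqF. Qed.

Lemma partial_log i : partial i (log f) = lgrad f i.
Proof.
apply/funext => v; rewrite [LHS](_ : _ = partial i (@ln R \o f) v)//.
by rewrite (partial_comp i (smooth_differentiable v sf) (is_derive1_ln (f0 v))) mulrC.
Qed.

Lemma differentiable_lgrad i v : differentiable (lgrad f i) v.
Proof.
apply: differentiableM; first exact/smooth_differentiable/smooth_partial.
by apply: differentiableV => //; exact: smooth_differentiable.
Qed.

Lemma partial_lgrad i j v : partial i (lgrad f j) v = lhess f i j v.
Proof.
have d2 := is_derive_partial i (smooth_differentiable v (smooth_partial j sf)).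
have d3 := is_derive_partial_comp i (smooth_differentiable v sf) (is_derive1_inv (fn0 v)).
have [_ dE] := is_deriveM d2 d3; apply: etrans dE _.
rewrite /lhess /lgrad /GRing.scale/=; field.
exact: fn0.
Qed.

Lemma continuous_lgrad i : continuous (lgrad f i).
Proof. by move=> v; exact/differentiable_continuous/differentiable_lgrad. Qed.

Lemma continuous_lhess i j : continuous (lhess f i j).
Proof.
move=> v; apply: cvgB; last by apply: cvgM; exact: continuous_lgrad.
apply: cvgM; first exact/smooth_continuous/smooth_partial/smooth_partial.
by apply: cvgV; [|exact: smooth_continuous].
Qed.

(* Its square is the increment of the logarithmic gradient, weighted by f. *)
Definition hpsi (k : 'I_3) w v := (lgrad f k v - lgrad f k w) * Num.sqrt (f v).

Lemma differentiable_hpsi k w v : differentiable (hpsi k w) v.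
Proof.
apply: differentiableM.
  exact/differentiableB/differentiable_cst/differentiable_lgrad.
exact: (differentiable_comp1 (smooth_differentiable v sf) (is_derive1_sqrt (f0 v))).
Qed.

(** Product rule, with d_i sqrt f = (d_i h / 2) sqrt f: the factor sqrt f survives, so the squared
    gradient again has weight f. *)
Lemma partial_hpsi k w i v : partial i (hpsi k w) v =
  (lhess f i k v + (lgrad f k v - lgrad f k w) * lgrad f i v / 2) * Num.sqrt (f v).
Proof.
have ds := differentiable_comp1 (smooth_differentiable v sf) (is_derive1_sqrt (f0 v)).
have d1 := is_derive_partial i ds.
have d2 := is_derive_partial i (differentiable_lgrad k v).
have d3 : is_derive v (unitv i) (fun=> lgrad f k w) 0 by exact: is_derive_cst.
have [_ dE] := is_deriveM (is_deriveB d2 d3) d1; apply: etrans dE _.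
rewrite (partial_comp i (smooth_differentiable v sf) (is_derive1_sqrt (f0 v))).
rewrite partial_lgrad /GRing.scale/= !fctE/= /lgrad.
have s0 : Num.sqrt (f v) != 0 by rewrite gt_eqF// sqrtr_gt0.
have fE : f v = Num.sqrt (f v) ^+ 2 by rewrite sqr_sqrtr// ltW.
move: (Num.sqrt _) s0 fE => s s0 ->; field.
by rewrite s0 fn0.
Qed.

Lemma continuous_partial_hpsi k w i : continuous (partial i (hpsi k w)).
Proof.
have -> : partial i (hpsi k w) = fun v =>
    (lhess f i k v + (lgrad f k v - lgrad f k w) * lgrad f i v / 2) * Num.sqrt (f v).
  by apply/funext => v; exact: partial_hpsi.
move=> v; apply: cvgM; last first.
  have ds := differentiable_comp1 (smooth_differentiable v sf) (is_derive1_sqrt (f0 v)).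
  exact: (differentiable_continuous ds).
apply: cvgD; first exact: continuous_lhess.
apply: cvgM; last exact: cvg_cst.
apply: cvgM; last exact: continuous_lgrad.
by apply: cvgB; [exact: continuous_lgrad|exact: cvg_cst].
Qed.

Lemma gradlogE v i : grad (log f) v 0 i = lgrad f i v.
Proof. by rewrite mxE partial_log. Qed.

Lemma hesslogE v i j : hess (log f) v i j = lhess f i j v.
Proof. by rewrite mxE partial_log partial_lgrad. Qed.

End LogCalculus.

Lemma sum3E (R : realType) (F : 'I_3 -> R) :
  \sum_i F i = F ord0 + F (inord 1) + F ord_max.
Proof.
rewrite !big_ord_recl big_ord0 addr0 addrA.
by congr (F _ + F _ + F _); apply: val_inj; rewrite /= ?inordK.
Qed.

Lemma sum_sqr_prod (R : realType) (h : 'I_3 -> 'I_3 -> R) (c d : 'I_3 -> R) :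
  \sum_k \sum_i (2 * h i k ^+ 2 + c k * d i) =
  2 * (\sum_i \sum_k h i k ^+ 2) + (\sum_k c k) * (\sum_i d i).
Proof. by rewrite !sum3E; ring. Qed.

Section Energy.
Context {R : realType}.
Variable f : R * R * R -> R.
Hypotheses (sf : smooth f) (f0 : forall v, 0 < f v).
Hypothesis f1 : (\int[mu3]_v (f v)%:E = 1)%E.

Definition lgrad_sqr v := \sum_i lgrad f i v ^+ 2.
Definition lhess_sqr v := \sum_i \sum_j lhess f i j v ^+ 2.
(** A common majorant for all terms of V^2: the fourth power of grad h accounts for tensor products,
    f^2 for the term in c when gam = -3, and 1 for bounded terms and lower powers. *)
Definition energy v := 1 + lhess_sqr v + lgrad_sqr v ^+ 2 + f v ^+ 2.
Definition dgrad_sqr v w := \sum_k (lgrad f k v - lgrad f k w) ^+ 2.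

Lemma lgrad_sqr_ge0 v : 0 <= lgrad_sqr v.
Proof. by apply: sumr_ge0 => i _; rewrite sqr_ge0. Qed.

Lemma lhess_sqr_ge0 v : 0 <= lhess_sqr v.
Proof. by do 2 (apply: sumr_ge0 => ? _); rewrite sqr_ge0. Qed.

Lemma dgrad_sqr_ge0 v w : 0 <= dgrad_sqr v w.
Proof. by apply: sumr_ge0 => ? _; rewrite sqr_ge0. Qed.

Lemma energy_ge1 v : 1 <= energy v.
Proof.
have h1 := lhess_sqr_ge0 v; have h2 := sqr_ge0 (lgrad_sqr v); have h3 := sqr_ge0 (f v).
rewrite /energy; lra.
Qed.

Lemma energy_ge0 v : 0 <= energy v.
Proof. by rewrite (le_trans _ (energy_ge1 v)). Qed.

Let mf : measurable_fun [set: R3 R] f.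
Proof. exact: (continuous_measurable_fun3 (smooth_continuous sf)). Qed.

Let mg i : measurable_fun [set: R3 R] (lgrad f i).
Proof. exact: (continuous_measurable_fun3 (@continuous_lgrad R f sf f0 i)). Qed.

Let mh i j : measurable_fun [set: R3 R] (lhess f i j).
Proof. exact: (continuous_measurable_fun3 (@continuous_lhess R f sf f0 i j)). Qed.

Let mg2 : measurable_fun [set: R3 R] lgrad_sqr.
Proof. by apply: measurable_sum => i; exact: measurable_funX. Qed.

Let mh2 : measurable_fun [set: R3 R] lhess_sqr.
Proof. by do 2 (apply: measurable_sum => ?); exact: measurable_funX. Qed.

Lemma measurable_energy : measurable_fun [set: R3 R] energy.
Proof.
have mf2 := measurable_funX 2 mf; have mg4 := measurable_funX 2 mg2.
have m1 : measurable_fun [set: R3 R] (fun=> 1 : R) by exact: measurable_cst.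
exact: (measurable_funD (measurable_funD (measurable_funD m1 mh2) mg4) mf2).
Qed.

Let log_quarticE i v : log_quartic i f v = lgrad f i v ^+ 4 * f v.
Proof. rewrite /log_quartic /lgrad; field; by rewrite gt_eqF. Qed.

Let log_hess_sqrE i v : log_hess_sqr i f v = lhess f i i v ^+ 2 * f v.
Proof. by rewrite /log_hess_sqr /lhess /lgrad expr2. Qed.

(** 27 = 3 * 9: the one-dimensional constant 9 on each axis, and (a^2 + b^2 + c^2)^2 <= 3 (a^4 + b^4
    + c^4). Only diagonal second derivatives of h appear on the way. *)
Lemma integral_lgrad4_le : (\int[mu3]_v (lgrad_sqr v ^+ 2 * f v)%:E <=
  27%:E * \int[mu3]_v (lhess_sqr v * f v)%:E)%E.
Proof.
have fge v : 0 <= f v by rewrite ltW.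
have mq i : measurable_fun [set: R3 R] (fun v => (log_quartic i f v)%:E).
  apply/measurable_EFinP; rewrite (funext (log_quarticE i)).
  by apply: measurable_funM => //; exact: measurable_funX.
have ms i : measurable_fun [set: R3 R] (fun v => (log_hess_sqr i f v)%:E).
  apply/measurable_EFinP; rewrite (funext (log_hess_sqrE i)).
  by apply: measurable_funM => //; exact: measurable_funX.
have q0 i v : (0 <= (log_quartic i f v)%:E)%E.
  by rewrite log_quarticE lee_fin mulr_ge0// exprn_even_ge0.
have s0 i v : (0 <= (log_hess_sqr i f v)%:E)%E.
  by rewrite log_hess_sqrE lee_fin mulr_ge0// sqr_ge0.
apply: (@le_trans _ _ (\int[mu3]_v (3%:E * \sum_i (log_quartic i f v)%:E))%E).
  apply: ge0_le_integral_nonmeasurable => v.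
    by rewrite lee_fin mulr_ge0// sqr_ge0.
  rewrite sumEFin -EFinM lee_fin; under eq_bigr do rewrite log_quarticE.
  rewrite -mulr_suml mulrA ler_wpM2r// /lgrad_sqr !sum3E.
  move: (lgrad f ord0 v) (lgrad f (inord 1) v) (lgrad f ord_max v) => a b c.
  rewrite -subr_ge0 (_ : _ - _ = (a ^+ 2 - b ^+ 2) ^+ 2 + (a ^+ 2 - c ^+ 2) ^+ 2
    + (b ^+ 2 - c ^+ 2) ^+ 2); last by ring.
  by rewrite !addr_ge0// sqr_ge0.
rewrite (ge0_integralZl _ measurableT); last 3 first.
- exact: emeasurable_sum.
- by move=> v _; exact: sume_ge0.
- by [].
rewrite ge0_integral_sum//.
apply: (@le_trans _ _ (3%:E *
    \sum_(i < 3) (9%:E * \int[mu3]_v (log_hess_sqr i f v)%:E))%E).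
  rewrite lee_wpmul2l//; apply: lee_sum => i _.
  by apply: integral_log_quartic_le; rewrite ?f1 ?ltry.
rewrite -ge0_sume_distrr; last by move=> i _; apply: integral_ge0 => v _.
rewrite muleA -EFinM (_ : 3 * 9 = 27); last by ring.
rewrite lee_wpmul2l// -ge0_integral_sum//.
apply: ge0_le_integral_nonmeasurable => v; first exact: sume_ge0.
rewrite sumEFin lee_fin; under eq_bigr do rewrite log_hess_sqrE.
rewrite -mulr_suml ler_wpM2r// /lhess_sqr; apply: ler_sum => i _.
by rewrite (bigD1 i)//= lerDl sumr_ge0// => j _; rewrite sqr_ge0.
Qed.

Lemma integral_energy_le : (\int[mu3]_v (energy v * f v)%:E <=
  28%:E * (1 + \int[mu3]_v ((lhess_sqr v + lgrad_sqr v + f v ^+ 2) * f v)%:E))%E.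
Proof.
have fge v : 0 <= f v by rewrite ltW.
have h0 := lhess_sqr_ge0; have g0 := lgrad_sqr_ge0.
have mE (h : R3 R -> R) : measurable_fun [set: R3 R] h ->
    measurable_fun [set: R3 R] (fun v => (h v * f v)%:E).
  by move=> ?; apply/measurable_EFinP; exact: measurable_funM.
have mH := mE _ mh2; have mG := mE _ (measurable_funX 2 mg2).
have mF := mE _ (measurable_funX 2 mf).
set I := (\int[mu3]_v ((lhess_sqr v + _ + _) * f v)%:E)%E.
have I0 : (0 <= I)%E.
  by apply: integral_ge0 => v _; rewrite lee_fin mulr_ge0// !addr_ge0// sqr_ge0.
have HI : (\int[mu3]_v (lhess_sqr v * f v)%:E <= I)%E.
  apply: ge0_le_integral_nonmeasurable => v; first by rewrite lee_fin mulr_ge0.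
  by rewrite lee_fin ler_wpM2r// -addrA lerDl addr_ge0// sqr_ge0.
have FI : (\int[mu3]_v ((lhess_sqr v + f v ^+ 2) * f v)%:E <= I)%E.
  apply: ge0_le_integral_nonmeasurable => v.
    by rewrite lee_fin mulr_ge0// addr_ge0// sqr_ge0.
  by rewrite lee_fin ler_wpM2r// lerD2r lerDl.
have mf' : measurable_fun [set: R3 R] (fun v => (f v)%:E) by exact/measurable_EFinP.
apply: (@le_trans _ _ (\int[mu3]_v ((f v)%:E + ((lhess_sqr v + f v ^+ 2) * f v)%:E
    + (lgrad_sqr v ^+ 2 * f v)%:E))%E).
  apply: le_of_eq; apply: eq_integral => v _.
  by rewrite -!EFinD /energy; congr EFin; ring.
have mHF := mE _ (measurable_funD mh2 (measurable_funX 2 mf)).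
rewrite ge0_integralD//; last 3 first.
- by move=> v _; rewrite -EFinD lee_fin !addr_ge0// mulr_ge0// addr_ge0// sqr_ge0.
- exact: emeasurable_funD.
- by move=> v _; rewrite lee_fin mulr_ge0// sqr_ge0.
rewrite ge0_integralD//; last 2 first.
- by move=> v _; rewrite lee_fin.
- by move=> v _; rewrite lee_fin mulr_ge0// addr_ge0// sqr_ge0.
apply: (@le_trans _ _ (1 + I + 27%:E * I)%E).
  apply: leeD; first by apply: leeD => //; apply: le_of_eq; exact: f1.
  by apply: le_trans integral_lgrad4_le _; rewrite lee_wpmul2l.
(* 28 = 1 + 27, from 1 + I + 27 I; the case I = +oo is separate because real arithmetic does not
   cover it. *)
move: I0; case: (I) => [r r0||].
- by rewrite -EFinM -!EFinD -EFinM lee_fin; lra.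
- by move=> _; rewrite [leRHS](_ : _ = +oo)%E ?leey// addey// gt0_muley ?lte_fin.
- by [].
Qed.

(** Entrywise, (x + (a - b) c / 2)^2 <= 2 x^2 + (a^2 + b^2) c^2. Summation gives the squared Hessian
    of h and products of squared gradients at v and w, which the quartic part of [energy]
    dominates. *)
Lemma gradsq_hpsi_le v w :
  \sum_(k < 3) gradsq (hpsi f k w) v <= 2 * (energy v + energy w) * f v.
Proof.
have fge : 0 <= f v by rewrite ltW.
have -> : \sum_(k < 3) gradsq (hpsi f k w) v = (\sum_k \sum_i
    (lhess f i k v + (lgrad f k v - lgrad f k w) * lgrad f i v / 2) ^+ 2) * f v.
  rewrite mulr_suml; apply: eq_bigr => k _.
  rewrite -[in RHS](sqr_sqrtr fge) mulr_suml sum3E /gradsq !partial_hpsi//.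
  move: (lhess f _ k v) => h; move: (Num.sqrt _) (lgrad f k w) (lgrad f k v) => s b a.
  by move: (lgrad f) => g; rewrite !exprMn.
rewrite ler_wpM2r//.
apply: (@le_trans _ _ (\sum_k \sum_i (2 * lhess f i k v ^+ 2 +
    (lgrad f k v ^+ 2 + lgrad f k w ^+ 2) * lgrad f i v ^+ 2))).
  apply: ler_sum => k _; apply: ler_sum => i _.
  move: (lhess _ _ _ _) (lgrad f k v) (lgrad f k w) (lgrad f i v) => h a b c.
  rewrite -subr_ge0 (_ : _ - _ = (h - (a - b) * c / 2) ^+ 2 + (a + b) ^+ 2 * c ^+ 2 / 2).
    apply: addr_ge0; first exact: sqr_ge0.
    by apply: divr_ge0 => //; apply: mulr_ge0; exact: sqr_ge0.
  by field.
have -> : \sum_k \sum_i (2 * lhess f i k v ^+ 2 +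
    (lgrad f k v ^+ 2 + lgrad f k w ^+ 2) * lgrad f i v ^+ 2) =
  2 * lhess_sqr v + (lgrad_sqr v + lgrad_sqr w) * lgrad_sqr v.
  apply: etrans (sum_sqr_prod (fun i k => lhess f i k v)
    (fun k => lgrad f k v ^+ 2 + lgrad f k w ^+ 2) (fun i => lgrad f i v ^+ 2)) _.
  by rewrite big_split.
have h1 := lhess_sqr_ge0 w; have h2 := sqr_ge0 (f v); have h3 := sqr_ge0 (f w).
have h4 := sqr_ge0 (lgrad_sqr v - lgrad_sqr w).
have h5 := sqr_ge0 (lgrad_sqr v); have h6 := sqr_ge0 (lgrad_sqr w).
rewrite /energy; nra.
Qed.

(** Hardy is applied to each [hpsi f k w], which vanishes at w; 8 is its constant 4 times the 2 of
    [gradsq_hpsi_le]. Enlarging |z|^-2 to 1 + |z|^-2 matches the kernel of the other terms. *)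
Lemma hardy_lgrad w :
  (\int[mu3]_v (sqn (v - w) ^- 2 * dgrad_sqr v w * f v)%:E <=
   8%:E * \int[mu3]_v ((1 + (sqn (v - w))^-1) * (energy v + energy w) * f v)%:E)%E.
Proof.
have fge v : 0 <= f v by rewrite ltW.
have sq0 v : 0 <= sqn v := sqn_ge0 v.
have msw : measurable_fun [set: R3 R] (fun v : R3 R => sqn (v - w)).
  exact: measurable_sqn (measurable_subR3 (@measurable_id _ (R3 R) setT) (measurable_cst _)).
have msV : measurable_fun [set: R3 R] (fun v : R3 R => (sqn (v - w))^-1).
  exact: measurable_funV_ge0.
have mpsi k : measurable_fun [set: R3 R] (hpsi f k w).
  apply: continuous_measurable_fun3 => v.
  exact/differentiable_continuous/differentiable_hpsi.
have mL k : measurable_fun [set: R3 R]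
    (fun v => (sqn (v - w) ^- 2 * hpsi f k w v ^+ 2)%:E).
  apply/measurable_EFinP; apply: measurable_funM; last exact: measurable_funX.
  by under eq_fun do rewrite -exprVn; exact: measurable_funX.
have mgs k : measurable_fun [set: R3 R] (gradsq (hpsi f k w)).
  have mp i : measurable_fun [set: R3 R] (partial i (hpsi f k w)).
    by apply: continuous_measurable_fun3; exact: continuous_partial_hpsi.
  have mp2 i := measurable_funX 2 (mp i).
  exact: (measurable_funD (measurable_funD (mp2 _) (mp2 _)) (mp2 _)).
have mG k : measurable_fun [set: R3 R]
    (fun v => ((sqn (v - w))^-1 * gradsq (hpsi f k w) v)%:E).
  by apply/measurable_EFinP; exact: measurable_funM.
have L0 k v : (0 <= (sqn (v - w) ^- 2 * hpsi f k w v ^+ 2)%:E)%E.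
  by rewrite lee_fin mulr_ge0 ?invr_ge0 ?sqr_ge0.
have G0 k v : (0 <= ((sqn (v - w))^-1 * gradsq (hpsi f k w) v)%:E)%E.
  by rewrite lee_fin mulr_ge0 ?invr_ge0 ?gradsq_ge0 ?sqn_ge0.
apply: (@le_trans _ _ (\int[mu3]_v
    \sum_(k < 3) (sqn (v - w) ^- 2 * hpsi f k w v ^+ 2)%:E)%E).
  apply: le_of_eq; apply: eq_integral => v _.
  rewrite sumEFin -mulr_sumr -mulrA; congr (_ * _)%:E.
  rewrite /dgrad_sqr mulr_suml; apply: eq_bigr => k _.
  by rewrite /hpsi exprMn sqr_sqrtr.
rewrite ge0_integral_sum//.
apply: (@le_trans _ _ (\sum_(k < 3) (4%:E *
    \int[mu3]_v ((sqn (v - w))^-1 * gradsq (hpsi f k w) v)%:E))%E).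
  apply: lee_sum => k _; apply: hardy.
  - by move=> v; exact: differentiable_hpsi.
  - by move=> i; exact: continuous_partial_hpsi.
  - by rewrite /hpsi subrr mul0r.
rewrite -ge0_sume_distrr; last by move=> k _; exact: integral_ge0.
rewrite -ge0_integral_sum//.
have -> : (8%:E = 4%:E * 2%:E :> \bar R)%E by rewrite -EFinM; congr EFin; ring.
rewrite -muleA lee_wpmul2l//.
rewrite -(ge0_integralZl _ measurableT); last 3 first.
- apply/measurable_EFinP; apply: measurable_funM => //; apply: measurable_funM.
    exact: (measurable_funD (measurable_cst (1 : R)) msV).
  exact: (measurable_funD measurable_energy (measurable_cst _)).
- move=> v _; rewrite lee_fin; apply: mulr_ge0 => //; apply: mulr_ge0; apply: addr_ge0;
    by rewrite ?invr_ge0 ?energy_ge0 ?sqn_ge0 ?ler01.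
- by [].
apply: ge0_le_integral_nonmeasurable => v; first exact: sume_ge0.
rewrite sumEFin -mulr_sumr -EFinM lee_fin.
apply: (@le_trans _ _ ((1 + (sqn (v - w))^-1) *
    (2 * (energy v + energy w) * f v))); last first.
  by apply: le_of_eq; ring.
have gs0 : 0 <= \sum_(k < 3) gradsq (hpsi f k w) v.
  by apply: sumr_ge0 => k _; exact: gradsq_ge0.
apply: ler_pM => //; first by rewrite invr_ge0 sqn_ge0.
  by rewrite lerDr.
exact: gradsq_hpsi_le.
Qed.

End Energy.

(** * Double integrals in v and w *)

Section DoubleIntegral.
Context {R : realType}.
Variable f : R * R * R -> R.
Hypotheses (sf : smooth f) (f0 : forall v, 0 < f v).
Variable L : R.
Hypothesis L0 : 0 <= L.
Hypothesis fL : forall v,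
  (\int[mu3]_w ((1 + (sqn (v - w))^-1) * f w)%:E <= L%:E)%E.

Let fge v : 0 <= f v. Proof. by rewrite ltW. Qed.

Let kap0 (z : R * R * R) : 0 <= 1 + (sqn z)^-1.
Proof. by rewrite addr_ge0 ?invr_ge0 ?sqn_ge0. Qed.

Let mf : measurable_fun [set: R3 R] f.
Proof. exact: (continuous_measurable_fun3 (smooth_continuous sf)). Qed.

Let mP : measurable_fun [set: R3 R] (energy f).
Proof. exact: measurable_energy. Qed.

Let msV : measurable_fun [set: R3 R * R3 R] (fun z => (sqn (z.1 - z.2))^-1).
Proof.
apply: measurable_funV_ge0; first by move=> z; exact: sqn_ge0.
exact: measurable_sqn (measurable_subR3 measurable_fst measurable_snd).
Qed.

Let mK : measurable_fun [set: R3 R * R3 R] (fun z => 1 + (sqn (z.1 - z.2))^-1).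
Proof. exact: (measurable_funD (measurable_cst (1 : R)) msV). Qed.

Let mf1 : measurable_fun [set: R3 R * R3 R] (fun z => f z.1).
Proof. exact: (measurableT_comp mf measurable_fst). Qed.

Let mf2 : measurable_fun [set: R3 R * R3 R] (fun z => f z.2).
Proof. exact: (measurableT_comp mf measurable_snd). Qed.

Let mP1 : measurable_fun [set: R3 R * R3 R] (fun z => energy f z.1).
Proof. exact: (measurableT_comp mP measurable_fst). Qed.

Let mP2 : measurable_fun [set: R3 R * R3 R] (fun z => energy f z.2).
Proof. exact: (measurableT_comp mP measurable_snd). Qed.

Definition kernel_energy (z : R3 R * R3 R) :=
  (1 + (sqn (z.1 - z.2))^-1) * (energy f z.1 + energy f z.2) * f z.1 * f z.2.

Lemma measurable_kernel_energy : measurable_fun [set: R3 R * R3 R] kernel_energy.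
Proof.
have mKP := measurable_funM mK (measurable_funD mP1 mP2).
exact: (measurable_funM (measurable_funM mKP mf1) mf2).
Qed.

Lemma sqnC (v w : R * R * R) : sqn (v - w) = sqn (w - v).
Proof. by rewrite /sqn/=; ring. Qed.

Let mPf : measurable_fun [set: R3 R] (fun v => (energy f v * f v)%:E).
Proof. by apply/measurable_EFinP; exact: measurable_funM. Qed.

Let Pf0 v : (0 <= (energy f v * f v)%:E)%E.
Proof. by rewrite lee_fin mulr_ge0 ?energy_ge0. Qed.

(** The two energies are separated. Each time, integrating first in the variable not carrying the
    energy leaves the convolution bounded by L, whence 2 L. *)
Lemma integral_kernel_energy_le : (\int[mu3 \x mu3]_z (kernel_energy z)%:E <=
  (2 * L)%:E * \int[mu3]_v (energy f v * f v)%:E)%E.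
Proof.
pose Phi1 (z : R3 R * R3 R) :=
  (energy f z.1 * f z.1) * ((1 + (sqn (z.1 - z.2))^-1) * f z.2).
pose Phi2 (z : R3 R * R3 R) :=
  (energy f z.2 * f z.2) * ((1 + (sqn (z.2 - z.1))^-1) * f z.1).
have mPhi1 : measurable_fun [set: R3 R * R3 R] (EFin \o Phi1).
  apply/measurable_EFinP.
  exact: (measurable_funM (measurable_funM mP1 mf1) (measurable_funM mK mf2)).
have mPhi2 : measurable_fun [set: R3 R * R3 R] (EFin \o Phi2).
  apply/measurable_EFinP.
  have mK' : measurable_fun [set: R3 R * R3 R] (fun z => 1 + (sqn (z.2 - z.1))^-1).
    by under eq_fun do rewrite sqnC.
  exact: (measurable_funM (measurable_funM mP2 mf2) (measurable_funM mK' mf1)).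
have Phi10 z : (0 <= (EFin \o Phi1) z)%E.
  by rewrite lee_fin; do 2 apply: mulr_ge0; rewrite ?energy_ge0 ?mulr_ge0.
have Phi20 z : (0 <= (EFin \o Phi2) z)%E.
  by rewrite lee_fin; do 2 apply: mulr_ge0; rewrite ?energy_ge0 ?mulr_ge0.
have inner v : (\int[mu3]_w ((energy f v * f v) * ((1 + (sqn (v - w))^-1) * f w))%:E <=
    L%:E * (energy f v * f v)%:E)%E.
  under eq_integral do rewrite EFinM.
  rewrite (ge0_integralZl _ measurableT); last 3 first.
  - apply/measurable_EFinP; apply: measurable_funM => //.
    exact: (measurableT_comp mK (pair1_measurable v)).
  - by move=> w _; rewrite lee_fin mulr_ge0.
  - exact: Pf0.
  by rewrite muleC lee_wpmul2r.
have outer : (\int[mu3]_v (L%:E * (energy f v * f v)%:E) =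
    L%:E * \int[mu3]_v (energy f v * f v)%:E)%E.
  by rewrite (ge0_integralZl _ measurableT mPf).
apply: (@le_trans _ _ (\int[mu3 \x mu3]_z ((EFin \o Phi1) z + (EFin \o Phi2) z))%E).
  apply: le_of_eq; apply: eq_integral => z _.
  by rewrite /= -EFinD /Phi1 /Phi2 /kernel_energy (sqnC z.2); congr EFin; ring.
rewrite (ge0_integralD _ measurableT); [|by []|by []|by []|by []].
rewrite (_ : 2 * L = L + L); last by ring.
rewrite EFinD ge0_muleDl//; apply: leeD.
- rewrite -outer fubini_tonelli1//; apply: ge0_le_integral_nonmeasurable => v.
    by apply: integral_ge0 => w _; exact: Phi10.
  exact: inner.
- rewrite -outer fubini_tonelli2//; apply: ge0_le_integral_nonmeasurable => v.
    by apply: integral_ge0 => w _; exact: Phi20.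
  exact: inner.
Qed.

Let mdgrad : measurable_fun [set: R3 R * R3 R] (fun z => dgrad_sqr f z.1 z.2).
Proof.
apply: measurable_sum => k; apply: measurable_funX.
have mg : measurable_fun [set: R3 R] (lgrad f k).
  exact: (continuous_measurable_fun3 (@continuous_lgrad R f sf f0 k)).
exact: (measurable_funB (measurableT_comp mg measurable_fst)
  (measurableT_comp mg measurable_snd)).
Qed.

Definition kernel_dgrad (z : R3 R * R3 R) :=
  sqn (z.1 - z.2) ^- 2 * dgrad_sqr f z.1 z.2 * f z.1 * f z.2.

Let msV2 : measurable_fun [set: R3 R * R3 R] (fun z => sqn (z.1 - z.2) ^- 2).
Proof. by under eq_fun do rewrite -exprVn; exact: measurable_funX. Qed.

Lemma measurable_kernel_dgrad : measurable_fun [set: R3 R * R3 R] kernel_dgrad.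
Proof.
exact: (measurable_funM (measurable_funM (measurable_funM msV2 mdgrad) mf1) mf2).
Qed.

Lemma kernel_dgrad_ge0 z : 0 <= kernel_dgrad z.
Proof. by rewrite /kernel_dgrad !mulr_ge0 ?invr_ge0 ?sqr_ge0 ?dgrad_sqr_ge0. Qed.

Lemma kernel_energy_ge0 z : 0 <= kernel_energy z.
Proof.
do 2 (apply: mulr_ge0 => //); apply: mulr_ge0; first exact: kap0.
by rewrite addr_ge0 ?energy_ge0.
Qed.

(** [hardy_lgrad] at fixed w, multiplied by f w and integrated in w by Tonelli. *)
Lemma integral_kernel_dgrad_le :
  (\int[mu3 \x mu3]_z (kernel_dgrad z)%:E <=
   8%:E * \int[mu3 \x mu3]_z (kernel_energy z)%:E)%E.
Proof.
have mPsiE : measurable_fun [set: R3 R * R3 R] (EFin \o kernel_dgrad).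
  by apply/measurable_EFinP; exact: measurable_kernel_dgrad.
have mPhiE : measurable_fun [set: R3 R * R3 R] (EFin \o kernel_energy).
  by apply/measurable_EFinP; exact: measurable_kernel_energy.
have Psi0 z : (0 <= (EFin \o kernel_dgrad) z)%E by rewrite lee_fin kernel_dgrad_ge0.
have Phi0 z : (0 <= (EFin \o kernel_energy) z)%E by rewrite lee_fin kernel_energy_ge0.
rewrite [X in (X <= _)%E](fubini_tonelli2 (EFin \o kernel_dgrad))//.
rewrite [X in (_ * X)%E](fubini_tonelli2 (EFin \o kernel_energy))//.
rewrite -(ge0_integralZl _ measurableT); last 3 first.
- exact: (measurable_fun_fubini_tonelli_G (EFin \o kernel_energy)).
- by move=> w _; apply: integral_ge0 => v _; exact: Phi0.
- by [].
apply: ge0_le_integral_nonmeasurable => w.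
  by apply: integral_ge0 => v _; exact: Psi0.
have mp2 : measurable_fun [set: R3 R] (fun v : R3 R => (v, w)) by exact: pair2_measurable.
have m1 : measurable_fun [set: R3 R]
    (fun v => (sqn (v - w) ^- 2 * dgrad_sqr f v w * f v)%:E).
  apply/measurable_EFinP.
  exact: (measurable_funM (measurable_funM (measurableT_comp msV2 mp2)
    (measurableT_comp mdgrad mp2)) mf).
have m2 : measurable_fun [set: R3 R]
    (fun v => ((1 + (sqn (v - w))^-1) * (energy f v + energy f w) * f v)%:E).
  apply/measurable_EFinP.
  exact: (measurable_funM (measurable_funM (measurableT_comp mK mp2)
    (measurable_funD mP (measurable_cst _))) mf).
have -> : fubini_G mu3 (EFin \o kernel_dgrad) w = ((f w)%:E *
    \int[mu3]_v (sqn (v - w) ^- 2 * dgrad_sqr f v w * f v)%:E)%E.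
  rewrite -(ge0_integralZl _ measurableT m1); last 2 first.
  - by move=> v _; rewrite lee_fin !mulr_ge0 ?invr_ge0 ?sqr_ge0 ?dgrad_sqr_ge0.
  - by rewrite lee_fin.
  by apply: eq_integral => v _; rewrite -EFinM /= /kernel_dgrad/= mulrC.
have -> : fubini_G mu3 (EFin \o kernel_energy) w = ((f w)%:E *
    \int[mu3]_v ((1 + (sqn (v - w))^-1) * (energy f v + energy f w) * f v)%:E)%E.
  rewrite -(ge0_integralZl _ measurableT m2); last 2 first.
  - move=> v _; rewrite lee_fin; apply: mulr_ge0 => //; apply: mulr_ge0 => //.
    by rewrite addr_ge0 ?energy_ge0.
  - by rewrite lee_fin.
  by apply: eq_integral => v _; rewrite -EFinM /= /kernel_energy/= mulrC.
rewrite muleCA; apply: lee_wpmul2l; first by rewrite lee_fin.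
exact: hardy_lgrad.
Qed.

End DoubleIntegral.

(** * Pointwise bound on the test function *)

Section CauchySchwarz.
Context {R : realType}.

(** Lagrange's identity: once the double sum A is symmetrised, the difference is half the sum of the
    (x_i y_j - x_j y_i)^2. *)
Lemma cauchy_schwarz_sum (I : finType) (x y : I -> R) :
  (\sum_i x i * y i) ^+ 2 <= (\sum_i x i ^+ 2) * (\sum_i y i ^+ 2).
Proof.
rewrite expr2 !big_distrlr/= -subr_ge0.
set A := \sum_i \sum_j x i ^+ 2 * y j ^+ 2.
have AE : A = (\sum_i \sum_j (x i ^+ 2 * y j ^+ 2 + x j ^+ 2 * y i ^+ 2)) / 2.
  rewrite (_ : \sum_i \sum_j _ = A + \sum_j \sum_i x i ^+ 2 * y j ^+ 2).
    by rewrite [X in _ + X]exchange_big/= -/A; field.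
  by rewrite -big_split; apply: eq_bigr => i _; rewrite -big_split.
rewrite AE mulr_suml -sumrB sumr_ge0// => i _.
rewrite mulr_suml -sumrB sumr_ge0// => j _.
rewrite (_ : _ - _ = (x i * y j - x j * y i) ^+ 2 / 2) ?divr_ge0 ?sqr_ge0//.
by field.
Qed.

Lemma dot_sqr_le (x y : 'rV[R]_3) : dot x y ^+ 2 <= dot x x * dot y y.
Proof. exact: cauchy_schwarz_sum. Qed.

Lemma mxdot_sqr_le (A B : 'M[R]_3) : mxdot A B ^+ 2 <= mxdot A A * mxdot B B.
Proof.
rewrite /mxdot !pair_bigA/=.
exact: (@cauchy_schwarz_sum _ (fun p => A p.1 p.2) (fun p => B p.1 p.2)).
Qed.

End CauchySchwarz.

Section Coefficients.
Context {R : realType}.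
Variable gam : R.
Hypothesis hgam : - 3 <= gam <= - 2.
Implicit Types z : R * R * R.

Lemma powR_le_1D (t e : R) : 0 < t -> - 2 <= e <= 0 -> t `^ e <= 1 + (t ^+ 2)^-1.
Proof.
move=> t0 /andP[e2 e0]; have t2 : 0 < t ^+ 2 by rewrite exprn_gt0.
have [t1|t1] := leP 1 t.
  rewrite (@le_trans _ _ 1)//; last by rewrite lerDl invr_ge0 ltW.
  by rewrite -(powRr0 t); exact: ler_powR.
rewrite (@le_trans _ _ (t ^+ 2)^-1)//; last by rewrite lerDr.
rewrite -(powR_invn 2 (ltW t0)); apply: ger_powR => //.
by rewrite t0 ltW.
Qed.

Lemma powR_sqr_sqn2_le z :
  (enorm z `^ gam) ^+ 2 * sqn z ^+ 2 <= 1 + (sqn z)^-1.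
Proof.
case/andP: hgam => g3 g2.
have [z0|z_neq0] := eqVneq (sqn z) 0.
  by rewrite z0 expr0n/= mulr0 invr0 addr0.
have t0 : 0 < enorm z.
  rewrite lt_neqAle enorm_ge0 andbT eq_sym; apply: contra z_neq0 => /eqP h.
  by rewrite -enorm_sqr h expr0n.
have -> : (enorm z `^ gam) ^+ 2 * sqn z ^+ 2 = enorm z `^ (2 * gam + 4).
  rewrite -enorm_sqr -exprM powRD; last by rewrite (gt_eqF t0) implybT.
  rewrite (powR_mulrn 4 (enorm_ge0 z)); congr (_ * _).
  by rewrite [2 * gam]mulrC powRrM (powR_mulrn 2 (powR_ge0 _ _)).
by rewrite -enorm_sqr; apply: powR_le_1D => //; lra.
Qed.

Lemma powR_sqr_sqn_le z :
  (enorm z `^ gam) ^+ 2 * sqn z <= (sqn z)^-1 + sqn z ^- 2.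
Proof.
have [z0|z_neq0] := eqVneq (sqn z) 0.
  by rewrite z0 expr0n/= mulr0 invr0 addr0.
have := ler_wpM2l (_ : 0 <= (sqn z)^-1) (powR_sqr_sqn2_le z).
rewrite invr_ge0 sqn_ge0 => /(_ isT); congr (_ <= _); field; exact: z_neq0.
Qed.

Lemma coordsE z : (coords z 0 ord0 = z.1.1) * (coords z 0 (inord 1) = z.1.2) *
  (coords z 0 ord_max = z.2).
Proof. by rewrite !mxE/= inordK. Qed.

Lemma coef_aE z i j : coef_a gam z i j =
  enorm z `^ gam * (sqn z *+ (i == j) - coords z 0 i * coords z 0 j).
Proof. by rewrite !mxE big_ord1 !mxE enorm_sqr. Qed.

(** The matrix |z|^2 Id - z (x) z is |z|^2 times the projection onto the plane orthogonal to z, of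
    squared norm 2 for z nonzero. *)
Lemma mxdot_coef_a z : mxdot (coef_a gam z) (coef_a gam z) =
  2 * ((enorm z `^ gam) ^+ 2 * sqn z ^+ 2).
Proof.
have o01 : (ord0 == inord 1 :> 'I_3) = false.
  by apply/eqP => /(congr1 val); rewrite /= inordK.
have o12 : (inord 1 == ord_max :> 'I_3) = false.
  by apply/eqP => /(congr1 val); rewrite /= inordK.
have o02 : (ord0 == ord_max :> 'I_3) = false by [].
rewrite /mxdot !sum3E !coef_aE !coordsE !eqxx [inord 1 == _]eq_sym o01 o12 o02.
rewrite [ord_max == ord0]eq_sym [ord_max == inord 1]eq_sym o02 o12 !mulr1n !mulr0n !sub0r.
move: (_ `^ _) => t; rewrite /sqn; ring.
Qed.

Lemma dot_coef_b z : dot (coef_b gam z) (coef_b gam z) =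
  4 * ((enorm z `^ gam) ^+ 2 * sqn z).
Proof.
rewrite /dot !sum3E /coef_b !mxE/= inordK//=.
move: (_ `^ _) => t; rewrite /sqn; ring.
Qed.

End Coefficients.

Section PointwiseBound.
Context {R : realType}.
Variable gam : R.
Hypothesis hgam : - 3 <= gam <= - 2.
Variable f : R * R * R -> R.
Hypotheses (sf : smooth f) (f0 : forall v, 0 < f v).
Variable L : R.
Hypothesis L0 : 0 <= L.
Hypothesis fL : forall v,
  (\int[mu3]_w ((1 + (sqn (v - w))^-1) * f w)%:E <= L%:E)%E.

Let fge v : 0 <= f v. Proof. by rewrite ltW. Qed.

Let mf : measurable_fun [set: R3 R] f.
Proof. exact: (continuous_measurable_fun3 (smooth_continuous sf)). Qed.

(** The bound on the integral of |g| also provides integrability, which makes the real-valued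
    integral meaningful. *)
Lemma normr_Rintegral_le (g : R3 R -> R) (B : R) : measurable_fun [set: R3 R] g ->
  (\int[mu3]_w `|g w|%:E <= B%:E)%E -> `| \int[mu3]_w g w | <= B.
Proof.
move=> mg gB.
have ig : mu3.-integrable [set: R3 R] (EFin \o g).
  apply/integrableP; split; first exact/measurable_EFinP.
  by apply: le_lt_trans gB _; rewrite ltry.
apply: le_trans (le_normr_Rintegral measurableT ig) _.
have g0 : (0 <= \int[mu3]_w `|g w|%:E)%E by apply: integral_ge0 => w _; rewrite lee_fin.
rewrite -lee_fin /Rintegral fineK// ge0_fin_numE//.
by apply: le_lt_trans gB _; rewrite ltry.
Qed.

Lemma measurable_enorm_powR (v : R3 R) (e : R) :
  measurable_fun [set: R3 R] (fun w : R3 R => enorm (v - w) `^ e).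
Proof.
apply: (measurableT_comp (measurable_powR e)).
under eq_fun do rewrite enormE -powR12_sqrt ?sqn_ge0//.
apply: (measurableT_comp (measurable_powR _)).
exact: measurable_sqn (measurable_subR3 (measurable_cst v) (@measurable_id _ (R3 R) setT)).
Qed.

Lemma measurable_coef_a (v : R3 R) i j :
  measurable_fun [set: R3 R] (fun w : R3 R => coef_a gam (v - w) i j).
Proof.
have mvw := measurable_subR3 (measurable_cst v) (@measurable_id _ (R3 R) setT).
have mc k : measurable_fun [set: R3 R] (fun w : R3 R => coords (v - w) 0 k).
  have [m1 m2 m3] := measurable_coords mvw.
  by move: k; apply: ord3P; under eq_fun do rewrite coordsE.
under eq_fun do rewrite coef_aE.
apply: measurable_funM; first exact: measurable_enorm_powR.
apply: measurable_funB; last exact: measurable_funM.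
have ms := measurable_sqn mvw.
by case: (i == j) => //=.
Qed.

Lemma normr_coef_a_le z i j : `|coef_a gam z i j| <= 3 * (1 + (sqn z)^-1).
Proof.
have h1 := powR_sqr_sqn2_le hgam z.
have h2 : coef_a gam z i j ^+ 2 <= mxdot (coef_a gam z) (coef_a gam z).
  rewrite /mxdot (bigD1 i)//= (bigD1 j)//= -expr2 -addrA lerDl addr_ge0//.
    by apply: sumr_ge0 => k _; rewrite -expr2 sqr_ge0.
  by do 2 (apply: sumr_ge0 => ? _); rewrite -expr2 sqr_ge0.
rewrite mxdot_coef_a in h2.
have h3 : 0 <= (sqn z)^-1 by rewrite invr_ge0 sqn_ge0.
(* With x the absolute value of the entry, 2 x <= 1 + x^2 turns the bound on x^2 into one on x
   linear in 1 + |z|^-2, the kernel whose convolution with f is controlled. *)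
have h4 := sqr_ge0 (`|coef_a gam z i j| - 1).
have h5 := real_normK (num_real (coef_a gam z i j)).
move: h1 h2 h3 h4; rewrite -h5.
move: (`|_|) (_ * _) (_^-1) => x y t; nra.
Qed.

Lemma normr_conv_a_le v i j : `|conv_a gam f v i j| <= 3 * L.
Proof.
rewrite mxE; apply: normr_Rintegral_le.
  by apply: measurable_funM => //; exact: measurable_coef_a.
apply: (@le_trans _ _ (\int[mu3]_w (3%:E * ((1 + (sqn (v - w))^-1) * f w)%:E))%E).
  apply: ge0_le_integral_nonmeasurable => w; first by rewrite lee_fin.
  rewrite -EFinM lee_fin normrM (ger0_norm (fge w)) mulrA ler_wpM2r//.
  exact: normr_coef_a_le.
have msq : measurable_fun [set: R3 R] (fun w : R3 R => (sqn (v - w))^-1).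
  apply: measurable_funV_ge0; first by move=> w; exact: sqn_ge0.
  exact: measurable_sqn (measurable_subR3 (measurable_cst v) (@measurable_id _ (R3 R) setT)).
rewrite (ge0_integralZl _ measurableT); last 3 first.
- apply/measurable_EFinP; apply: measurable_funM => //.
  exact: (measurable_funD (measurable_cst (1 : R)) msq).
- by move=> w _; rewrite lee_fin mulr_ge0// addr_ge0 ?invr_ge0 ?sqn_ge0.
- by [].
by rewrite EFinM lee_wpmul2l.
Qed.

Let Q v i j := lhess f i j v + lgrad f i v * lgrad f j v.

Lemma hess_divE v i j : ((f v)^-1 *: hess f v) i j = Q v i j.
Proof. by rewrite !mxE /Q /lhess subrK mulrC. Qed.

Lemma sum_sqr_tensor (a b : 'I_3 -> R) :
  \sum_i \sum_j (a i * b j) ^+ 2 = (\sum_i a i ^+ 2) * (\sum_j b j ^+ 2).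
Proof.
rewrite big_distrlr/=; apply: eq_bigr => i _; apply: eq_bigr => j _.
by rewrite exprMn.
Qed.

Lemma mxdot_hess_div_le v :
  mxdot ((f v)^-1 *: hess f v) ((f v)^-1 *: hess f v) <= 2 * energy f v.
Proof.
rewrite /mxdot.
apply: (@le_trans _ _ (2 * (\sum_i \sum_j lhess f i j v ^+ 2 +
   \sum_i \sum_j (lgrad f i v * lgrad f j v) ^+ 2))).
  rewrite -big_split mulr_sumr; apply: ler_sum => i _.
  rewrite -big_split mulr_sumr; apply: ler_sum => j _.
  rewrite !hess_divE /Q.
  move: (lhess f i j v) (lgrad f i v * _) => a b /=; have := sqr_ge0 (a - b); nra.
rewrite sum_sqr_tensor ler_wpM2l// /energy -expr2.
have := sqr_ge0 (f v); rewrite -/(lhess_sqr f v) -/(lgrad_sqr f v); lra.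
Qed.

Lemma mxdot_hess_tensor_le v w (B : 'M[R]_3) :
  B = (f v)^-1 *: hess f v - tensor (grad (log f) v) (grad (log f) w) ->
  mxdot B B <= 6 * (energy f v + energy f w).
Proof.
move=> BE.
apply: (@le_trans _ _ (3 * (\sum_i \sum_j lhess f i j v ^+ 2 +
   \sum_i \sum_j (lgrad f i v * lgrad f j v) ^+ 2 +
   \sum_i \sum_j (lgrad f i v * lgrad f j w) ^+ 2))).
  rewrite -!big_split mulr_sumr; apply: ler_sum => i _.
  rewrite -!big_split mulr_sumr; apply: ler_sum => j _.
  have -> : B i j = Q v i j - lgrad f i v * lgrad f j w.
    by rewrite BE -hess_divE !mxE big_ord1 !mxE !partial_log.
  rewrite /Q; move: (lgrad f i v * lgrad f j v) (lgrad f i v * lgrad f j w) => b c.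
  move: (lhess f i j v) => a.
  have h1 := sqr_ge0 (a - b); have h2 := sqr_ge0 (a + c); have h3 := sqr_ge0 (b + c).
  rewrite /=; nra.
rewrite !sum_sqr_tensor /energy -!/(lhess_sqr f _) -!/(lgrad_sqr f _).
have h1 := lhess_sqr_ge0 f w; have h2 := sqr_ge0 (f v); have h3 := sqr_ge0 (f w).
have h4 := sqr_ge0 (lgrad_sqr f v - lgrad_sqr f w); have h5 := lhess_sqr_ge0 f v.
have h6 := sqr_ge0 (lgrad_sqr f v); have h7 := sqr_ge0 (lgrad_sqr f w).
nra.
Qed.

(** The summand 1 of [energy] pays for passing from squares to fourth powers of grad h. *)
Lemma dgrad_sqr_le v w : dgrad_sqr f v w <= 2 * (energy f v + energy f w).
Proof.
apply: (@le_trans _ _ (2 * (lgrad_sqr f v + lgrad_sqr f w))).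
  rewrite /dgrad_sqr /lgrad_sqr -big_split mulr_sumr; apply: ler_sum => k _.
  move: (lgrad f k v) (lgrad f k w) => a b; have := sqr_ge0 (a + b); rewrite /=; nra.
have h1 := lhess_sqr_ge0 f w; have h2 := sqr_ge0 (f v); have h3 := sqr_ge0 (f w).
have h5 := lhess_sqr_ge0 f v.
have h6 := sqr_ge0 (lgrad_sqr f v - 1); have h7 := sqr_ge0 (lgrad_sqr f w - 1).
rewrite /energy; nra.
Qed.

(** V has four terms, so V^2 is at most 4 times the sum of their squares: 80 = 4 (12 + 8), with 12
    from a and 8 from the mild part of b; 648 = 4 * 162, with 162 = 9 * 3^2 * 2 from the convolution
    with a; 16 = 4 * 4 from the |z|^-4 part of b. *)
Lemma V_sqr_le (C5 : R) v w : conv_c gam f v ^+ 2 <= C5 * energy f v -> 0 <= C5 ->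
  V gam f v w ^+ 2 <=
    (80 + 648 * L ^+ 2 + 4 * C5) * ((1 + (sqn (v - w))^-1) * (energy f v + energy f w))
    + 16 * (sqn (v - w) ^- 2 * dgrad_sqr f v w).
Proof.
move=> hc C50.
rewrite /V; set a := coef_a _ _; set b := coef_b _ _; set B := _ - tensor _ _.
set A := conv_a _ _ _; set Q' := _ *: _; set d := _ - grad _ _; set c := conv_c _ _ _.
set t := (sqn (v - w))^-1; rewrite -/c in hc.
have t0 : 0 <= t by rewrite invr_ge0 sqn_ge0.
have Ev := energy_ge1 f v; have Ew := energy_ge1 f w.
have D0 := dgrad_sqr_ge0 f v w; have Dle := dgrad_sqr_le v w.
have X1 : mxdot a B ^+ 2 <= 12 * ((1 + t) * (energy f v + energy f w)).
  apply: le_trans (mxdot_sqr_le a B) _.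
  rewrite (_ : 12 * _ = (2 * (1 + t)) * (6 * (energy f v + energy f w))); last by ring.
  apply: ler_pM; [by do 2 (apply: sumr_ge0 => ? _); rewrite -expr2 sqr_ge0|
    by do 2 (apply: sumr_ge0 => ? _); rewrite -expr2 sqr_ge0| |
    exact: mxdot_hess_tensor_le].
  by rewrite /a mxdot_coef_a ler_wpM2l//; exact: powR_sqr_sqn2_le.
have X3 : dot b d ^+ 2 <= 4 * (t + t ^+ 2) * dgrad_sqr f v w.
  apply: le_trans (dot_sqr_le b d) _.
  have -> : dot d d = dgrad_sqr f v w.
    by apply: eq_bigr => k _; rewrite !mxE !partial_log// expr2.
  rewrite ler_wpM2r// /b dot_coef_b ler_wpM2l// /t exprVn.
  exact: powR_sqr_sqn_le.
have X4 : mxdot A Q' ^+ 2 <= 162 * L ^+ 2 * energy f v.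
  apply: le_trans (mxdot_sqr_le A Q') _.
  rewrite (_ : 162 * _ * _ = (9 * (3 * L) ^+ 2) * (2 * energy f v)); last by ring.
  apply: ler_pM; [by do 2 (apply: sumr_ge0 => ? _); rewrite -expr2 sqr_ge0|
    by do 2 (apply: sumr_ge0 => ? _); rewrite -expr2 sqr_ge0| |exact: mxdot_hess_div_le].
  apply: (@le_trans _ _ (\sum_(i < 3) \sum_(j < 3) (3 * L) ^+ 2)).
    apply: ler_sum => i _; apply: ler_sum => j _; rewrite -expr2 -real_normK ?num_real//.
    by rewrite lerXn2r ?nnegrE ?mulr_ge0//; exact: normr_conv_a_le.
  by rewrite !sum3E; lra.
have -> : sqn (v - w) ^- 2 = t ^+ 2 by rewrite exprVn.
move: (mxdot a B) (dot b d) (mxdot A Q') c hc X1 X3 X4 => x1 x3 x4 x5 hc X1 X3 X4.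
apply: (@le_trans _ _ (4 * (x1 ^+ 2 + x3 ^+ 2 + x4 ^+ 2 + x5 ^+ 2))).
  rewrite -subr_ge0 (_ : 4 * (x1 ^+ 2 + x3 ^+ 2 + x4 ^+ 2 + x5 ^+ 2) -
    (- x1 - x3 + x4 - x5) ^+ 2 = (x1 - x3) ^+ 2 + (x1 + x4) ^+ 2 + (x1 - x5) ^+ 2 +
    (x3 + x4) ^+ 2 + (x3 - x5) ^+ 2 + (x4 + x5) ^+ 2); last by ring.
  by rewrite !addr_ge0// sqr_ge0.
move: (energy f v) (energy f w) (dgrad_sqr f v w) Ev Ew D0 Dle hc X1 X3 X4.
move=> p q D p1 q1 D0 Dle hc X1 X3 X4.
(* For the part of |b|^2 of order |z|^-2 the crude bound on D is enough; only t^2 D is kept for the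
   Hardy inequality. *)
have h1 : 4 * t * D <= 8 * (t * (p + q)).
  rewrite (_ : 8 * _ = 4 * t * (2 * (p + q))); last by ring.
  by rewrite ler_wpM2l// mulr_ge0.
have pq0 : 0 <= p + q by lra.
have h2 : p <= (1 + t) * (p + q).
  by have := mulr_ge0 t0 pq0; lra.
have h3 : 162 * L ^+ 2 * p <= 162 * L ^+ 2 * ((1 + t) * (p + q)).
  by rewrite ler_wpM2l// mulr_ge0// sqr_ge0.
have h4 : C5 * p <= C5 * ((1 + t) * (p + q)) by rewrite ler_wpM2l.
have h5 : t * (p + q) <= (1 + t) * (p + q) by rewrite ler_wpM2r// lerDr.
have -> : (80 + 648 * L ^+ 2 + 4 * C5) * ((1 + t) * (p + q)) + 16 * (t ^+ 2 * D) =
  4 * (12 * ((1 + t) * (p + q)) + (8 * ((1 + t) * (p + q)) + 4 * t ^+ 2 * D) +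
   162 * L ^+ 2 * ((1 + t) * (p + q)) + C5 * ((1 + t) * (p + q))) by ring.
have X3' : 4 * (t + t ^+ 2) * D = 4 * t * D + 4 * t ^+ 2 * D by ring.
have h6 : 4 * t * D <= 8 * ((1 + t) * (p + q)).
  by rewrite (le_trans h1)// ler_wpM2l.
rewrite ler_wpM2l//; apply: lerD; [apply: lerD; [apply: lerD|]|].
- exact: X1.
- by rewrite X3' in X3; rewrite (le_trans X3)// lerD2r.
- exact: (le_trans X4 h3).
- exact: (le_trans hc h4).
Qed.

End PointwiseBound.

(** * Essential supremum and convolution bounds *)

Section NormInfinity.
Context {R : realType}.

(** The L^oo norm unfolds to an essential supremum only on a space of positive measure. *)
Lemma mu3_setT_gt0 : (0 < @mu3 R setT)%E.
Proof.
apply: (@lt_le_trans _ _ (mu3 (ball ((0, 0, 0) : R * R * R) 1))).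
  by rewrite mu3_ball// lte_fin exprn_gt0// mulrn_wgt0.
by apply: le_measure; rewrite ?inE//; exact: measurable_ball3.
Qed.

Lemma ae_le_normLinf (f : R * R * R -> R) : (normLinf f < +oo)%E ->
  {ae (@mu3 R), forall v, f v <= fine (normLinf f)} /\ 0 <= fine (normLinf f).
Proof.
have fE : normLinf f = ess_sup mu3 (abse \o (EFin \o f)).
  by rewrite /normLinf unlock /= mu3_setT_gt0.
have f0 : (0 <= normLinf f)%E by exact: Lnorm_ge0.
move=> foo; split; last exact: fine_ge0.
have := @ess_sup_ge _ _ _ (@mu3 R) (abse \o (EFin \o f)).
rewrite -fE; apply: filterS => v /= fv.
rewrite -lee_fin fineK ?ge0_fin_numE//; apply: le_trans fv.
by rewrite lee_fin ler_norm.
Qed.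

End NormInfinity.

Section Convolution.
Context {R : realType}.
Variables (f : R * R * R -> R) (M : R).
Hypotheses (mf : measurable_fun [set: R3 R] f) (f0 : forall v, 0 <= f v).
Hypothesis f1 : (\int[mu3]_v (f v)%:E = 1)%E.
Hypotheses (fM : {ae (@mu3 R), forall v, f v <= M}) (M0 : 0 <= M).

Lemma integral_kernel_le (K : R) v :
  (\int[mu3]_w (enorm (v - w) `^ (- 2) * f w)%:E <= (1 + K * M)%:E)%E ->
  (\int[mu3]_w ((1 + (sqn (v - w))^-1) * f w)%:E <= (2 + K * M)%:E)%E.
Proof.
move=> hK.
have m2 := measurable_enorm_powR v (- 2).
have mfE : measurable_fun [set: R3 R] (fun w => (f w)%:E) by exact/measurable_EFinP.
have mg : measurable_fun [set: R3 R] (fun w => (enorm (v - w) `^ (- 2) * f w)%:E).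
  by apply/measurable_EFinP; exact: measurable_funM.
apply: (@le_trans _ _ (\int[mu3]_w ((f w)%:E + (enorm (v - w) `^ (- 2) * f w)%:E))%E).
  apply: le_of_eq; apply: eq_integral => w _.
  by rewrite -EFinD (powR_invn 2 (enorm_ge0 _)) enorm_sqr mulrDl mul1r.
rewrite (ge0_integralD _ measurableT); [|by move=> w _; rewrite lee_fin|by []|
  by move=> w _; rewrite lee_fin mulr_ge0 ?powR_ge0|by []].
rewrite (_ : 2 + K * M = 1 + (1 + K * M)); last by ring.
rewrite EFinD; apply: leeD => //.
by apply: le_of_eq; exact: f1.
Qed.

(** For gam = -3 the convolution is -8 pi f, whose square is paid by the f^2 in [energy]. Otherwise
    it is bounded by 2 (1 + K M), since gam + 3 <= 1, and energy >= 1 suffices. Adding both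
    constants covers the two cases at once. *)
Lemma conv_c_sqr_le (gam K : R) v : - 3 <= gam <= - 2 ->
  0 <= K ->
  (gam != - 3 -> (\int[mu3]_w (enorm (v - w) `^ gam * f w)%:E <= (1 + K * M)%:E)%E) ->
  conv_c gam f v ^+ 2 <= (64 * pi ^+ 2 + 4 * (1 + K * M) ^+ 2) * energy f v.
Proof.
move=> /andP[g3 g2] K0 hK.
have E1 := energy_ge1 f v.
have KM0 : 0 <= K * M by rewrite mulr_ge0.
rewrite mulrDl /conv_c; case: ifPn => [_|gn].
  apply: (@le_trans _ _ (64 * pi ^+ 2 * energy f v)); last first.
    rewrite lerDl; apply: mulr_ge0; last exact: energy_ge0.
    by apply: mulr_ge0 => //; exact: sqr_ge0.
  rewrite (_ : _ ^+ 2 = 64 * pi ^+ 2 * f v ^+ 2); last by ring.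
  apply: ler_wpM2l; first by apply: mulr_ge0 => //; exact: sqr_ge0.
  have := lhess_sqr_ge0 f v; have := sqr_ge0 (lgrad_sqr f v).
  rewrite /energy; lra.
apply: (@le_trans _ _ (4 * (1 + K * M) ^+ 2 * energy f v)); last first.
  rewrite lerDr; apply: mulr_ge0; last exact: energy_ge0.
  by apply: mulr_ge0 => //; exact: sqr_ge0.
apply: (@le_trans _ _ (4 * (1 + K * M) ^+ 2)); last first.
  by rewrite ler_peMr//; apply: mulr_ge0 => //; exact: sqr_ge0.
rewrite (_ : 4 * _ = (2 * (1 + K * M)) ^+ 2); last by ring.
rewrite -real_normK ?num_real// lerXn2r ?nnegrE ?mulr_ge0 ?addr_ge0//.
have mg := measurable_enorm_powR v gam.
apply: normr_Rintegral_le; first by apply: measurable_funM => //; exact: measurable_funM.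
apply: (@le_trans _ _ (\int[mu3]_w (2%:E * (enorm (v - w) `^ gam * f w)%:E))%E).
  apply: ge0_le_integral_nonmeasurable => w; first by rewrite lee_fin.
  rewrite -EFinM lee_fin !normrM (ger0_norm (f0 w)) (ger0_norm (powR_ge0 _ _)) mulrA.
  rewrite ler_wpM2r// ler_wpM2r ?powR_ge0// normrN (@ger0_norm _ 2)// ger0_norm; lra.
rewrite (ge0_integralZl _ measurableT); last 3 first.
- by apply/measurable_EFinP; exact: measurable_funM.
- by move=> w _; rewrite lee_fin mulr_ge0 ?powR_ge0.
- by [].
by rewrite EFinM lee_wpmul2l//; exact: hK.
Qed.

End Convolution.

Theorem lemma3p9 (R : realType) (gam : R) (hgam : - 3 <= gam <= - 2)
    (p n : R) (hp : 3 < p) (hn : 6 < 3 * (p - 1) < n) :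
  exists C : R -> R -> R, forall f : R * R * R -> R,
    smooth f -> (forall v, 0 < f v) -> probability_density f ->
    (normLinf f < +oo)%E -> (normLpn p n f < +oo)%E ->
    (\int[mu3 \x mu3]_z (`|V gam f z.1 z.2| ^+ 2 * f z.1 * f z.2)%:E
     <= (C (fine (normLinf f)) (fine (normLpn p n f)))%:E *
        (1 + \int[mu3]_v
               ((mxdot (hess (log f) v) (hess (log f) v)
                 + dot (grad (log f) v) (grad (log f) v)
                 + `|f v| ^+ 2) * f v)%:E))%E.
Proof.
have [g3 g2] := andP hgam.
have [K2 K20 hK2] : exists2 K : R, 0 <= K & forall (f : R * R * R -> R) (M : R) v,
    measurable_fun [set: R3 R] f -> (forall w, 0 <= f w) ->
    (\int[mu3]_w (f w)%:E = 1)%E ->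
    {ae (@mu3 R), forall w, f w <= M} -> 0 <= M ->
    (\int[mu3]_w (enorm (v - w) `^ (- 2) * f w)%:E <= (1 + K * M)%:E)%E.
  by apply: kernel_bound; lra.
have [Kg Kg0 hKg] : exists2 K : R, 0 <= K & gam != - 3 ->
    forall (f : R * R * R -> R) (M : R) v,
    measurable_fun [set: R3 R] f -> (forall w, 0 <= f w) ->
    (\int[mu3]_w (f w)%:E = 1)%E ->
    {ae (@mu3 R), forall w, f w <= M} -> 0 <= M ->
    (\int[mu3]_w (enorm (v - w) `^ gam * f w)%:E <= (1 + K * M)%:E)%E.
  (* At the critical exponent -3 [kernel_bound] does not apply, but the claim is vacuous and 0
     serves as K. *)
  have [->|gn] := eqVneq gam (- 3); first by exists 0.
  have [|K K0 hK] := @kernel_bound R gam; last by exists K.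
  by rewrite lt_neqAle eq_sym gn g3 (le_trans g2).
pose L M := 2 + K2 * M; pose C5 M := 64 * pi ^+ 2 + 4 * (1 + Kg * M) ^+ 2.
pose C1 M := 80 + 648 * L M ^+ 2 + 4 * C5 M.
(* 128 = 16 * 8 is the weight of [kernel_dgrad] in [V_sqr_le] times the constant of [hardy_lgrad]; 2
   L comes from the double integral of the energies, 28 from [integral_energy_le]. *)
exists (fun M _ => (C1 M + 128) * (2 * L M) * 28) => f sf f0 [mf fge f1] foo _.
have [fM M0] := ae_le_normLinf foo.
move: (fine (normLinf f)) fM M0 => M fM M0.
have L0 : 0 <= L M by rewrite addr_ge0// mulr_ge0.
have C50 : 0 <= C5 M.
  by rewrite /C5; have := sqr_ge0 (pi : R); have := sqr_ge0 (1 + Kg * M); lra.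
have C10 : 0 <= C1 M by rewrite /C1; move: (C5 M) C50 (sqr_ge0 (L M)) => c; lra.
have fL v : (\int[mu3]_w ((1 + (sqn (v - w))^-1) * f w)%:E <= (L M)%:E)%E.
  by apply: integral_kernel_le => //; exact: hK2.
have hc v : conv_c gam f v ^+ 2 <= C5 M * energy f v.
  by apply: conv_c_sqr_le => // gn; exact: hKg.
have mPhi := measurable_kernel_energy sf f0; have mPsi := measurable_kernel_dgrad sf f0.
have Phi0 := kernel_energy_ge0 f0; have Psi0 := kernel_dgrad_ge0 f0.
have Vle z : ((`|V gam f z.1 z.2| ^+ 2 * f z.1 * f z.2)%:E <=
    (C1 M)%:E * (kernel_energy f z)%:E + 16%:E * (kernel_dgrad f z)%:E)%E.
  rewrite -!EFinM -EFinD lee_fin real_normK ?num_real//.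
  have := V_sqr_le hgam sf f0 L0 fL z.2 (hc z.1) C50; rewrite -/(C1 M).
  have ff0 : 0 <= f z.1 * f z.2 by rewrite mulr_ge0 ?fge.
  move=> /(ler_wpM2r ff0); rewrite /kernel_energy /kernel_dgrad.
  congr (_ <= _); ring.
apply: (@le_trans _ _ (\int[mu3 \x mu3]_z
    ((C1 M)%:E * (kernel_energy f z)%:E + 16%:E * (kernel_dgrad f z)%:E))%E).
  apply: ge0_le_integral_nonmeasurable => // z.
  by rewrite lee_fin; apply: mulr_ge0; [apply: mulr_ge0; [exact: sqr_ge0|]|]; exact: fge.
have mPhiE : measurable_fun [set: R3 R * R3 R] (fun z => (kernel_energy f z)%:E).
  exact/measurable_EFinP.
have mPsiE : measurable_fun [set: R3 R * R3 R] (fun z => (kernel_dgrad f z)%:E).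
  exact/measurable_EFinP.
have Phi0E z : (0 <= (kernel_energy f z)%:E)%E by rewrite lee_fin.
have Psi0E z : (0 <= (kernel_dgrad f z)%:E)%E by rewrite lee_fin.
rewrite (ge0_integralD _ measurableT); last 4 first.
- by move=> z _; apply: mule_ge0; rewrite ?lee_fin.
- exact: measurable_funeM.
- by move=> z _; apply: mule_ge0; rewrite ?lee_fin.
- exact: measurable_funeM.
rewrite (ge0_integralZl _ measurableT mPhiE); [|by move=> z _; exact: Phi0E|by rewrite lee_fin].
rewrite (ge0_integralZl _ measurableT mPsiE); [|by move=> z _; exact: Psi0E|by rewrite lee_fin].
have I1 := integral_kernel_dgrad_le sf f0.
have I2 := integral_kernel_energy_le sf f0 L0 fL.
have I3 := integral_energy_le sf f0 f1.
set J := (\int[mu3 \x mu3]_z (kernel_energy f z)%:E)%E in I1 I2 *.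
set I := (X in (_ <= _ * (1 + X))%E).
have IE : I = (\int[mu3]_v ((lhess_sqr f v + lgrad_sqr f v + f v ^+ 2) * f v)%:E)%E.
  apply: eq_integral => v _; rewrite real_normK ?num_real//.
  congr ((_ + _ + _) * _)%:E.
    apply: eq_bigr => i _; apply: eq_bigr => j _.
    by rewrite hesslogE// expr2.
  by apply: eq_bigr => i _; rewrite gradlogE// expr2.
rewrite -IE in I3.
apply: (@le_trans _ _ ((C1 M)%:E * J + 16%:E * (8%:E * J))%E).
  by rewrite leeD2l// lee_wpmul2l.
rewrite muleA -EFinM -ge0_muleDl ?lee_fin// -EFinD.
rewrite (_ : C1 M + 16 * 8 = C1 M + 128); last by ring.
have C0 : 0 <= C1 M + 128 by move: (C1 M) C10 => c ?; lra.
rewrite -mulrA EFinM -muleA; apply: lee_wpmul2l; first by rewrite lee_fin.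
apply: le_trans I2 _; rewrite (EFinM (2 * L M)) -muleA; apply: lee_wpmul2l.
  by rewrite lee_fin mulr_ge0.
exact: I3.
Qed.
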